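(* Let $(\Lambda,d)$ be a finitely aligned $k$-graph. Then the fixed-point algebra $C^*(\Lambda)^\gamma$ of the gauge action is AF. If $\{t_\lambda:\lambda\in\Lambda\}$ is a Cuntz-Krieger $\Lambda$-family with $t_v\neq0$ for all $v\in\Lambda^0$, then the homomorphism $\pi_t$ of $C^*(\Lambda)$ such that $\pi_t(s_\lambda)=t_\lambda$ for all $\lambda\in\Lambda$ is injective on $C^*(\Lambda)^\gamma$.
   Context: Conventions: $0\in\mathbb{N}$; $\mathbb{N}^k$ is a semigroup with generators $e_1,\dots,e_k$, coordinatewise partial order $\le$, and $m\vee n$ denotes the coordinatewise maximum. A $k$-graph $(\Lambda,d)$ is a countable small category $\Lambda$ with a functor $d:\Lambda\to\mathbb{N}^k$ satisfying the factorisation property: if $d(\lambda)=m+n$ there are unique $\mu,\sigma\in\Lambda$ with $d(\mu)=m$, $d(\sigma)=n$, $\lambda=\mu\sigma$. Morphisms are called paths, objects vertices; $s$ and $r$ are the domain and codomain maps, so $\lambda\mu$ is defined when $s(\lambda)=r(\mu)$. $\Lambda^n:=\{\lambda:d(\lambda)=n\}$, and objects are identified with $\Lambda^0$. For $v\in\Lambda^0$, $v\Lambda:=\{\lambda\in\Lambda:r(\lambda)=v\}$. For $\lambda,\mu\in\Lambda$, $\Lambda^{\min}(\lambda,\mu):=\{(\alpha,\beta):\lambda\alpha=\mu\beta,\ d(\lambda\alpha)=d(\lambda)\vee d(\mu)\}$. $\Lambda$ is finitely aligned if every $\Lambda^{\min}(\lambda,\mu)$ is finite (possibly empty). A set $E\subset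 v\Lambda$ is exhaustive if for every $\mu\in v\Lambda$ there is $\lambda\in E$ with $\Lambda^{\min}(\lambda,\mu)\ne\emptyset$. A Cuntz-Krieger $\Lambda$-family is a collection $\{t_\lambda:\lambda\in\Lambda\}$ of partial isometries in a $C^*$-algebra such that (i) $\{t_v:v\in\Lambda^0\}$ are mutually orthogonal projections; (ii) $t_\lambda t_\mu=t_{\lambda\mu}$ whenever $s(\lambda)=r(\mu)$; (iii) $t_\lambda^*t_\mu=\sum_{(\alpha,\beta)\in\Lambda^{\min}(\lambda,\mu)}t_\alpha t_\beta^*$ for all $\lambda,\mu\in\Lambda$; (iv) $\prod_{\lambda\in E}(t_v-t_\lambda t_\lambda^* )=0$ for all $v\in\Lambda^0$ and all finite exhaustive $E\subset v\Lambda$. $C^*(\Lambda)$ is the universal $C^*$-algebra generated by a Cuntz-Krieger $\Lambda$-family $\{s_\lambda:\lambda\in\Lambda\}$: for each Cuntz-Krieger $\Lambda$-family $\{t_\lambda\}$ there is a unique homomorphism $\pi_t$ of $C^*(\Lambda)$ with $\pi_t(s_\lambda)=t_\lambda$ for all $\lambda$. Homomorphisms are $*$-homomorphisms. The gauge action $\gamma:\mathbb{T}^k\to\operatorname{Aut}(C^*(\Lambda))$ is the strongly continuous action determined by $\gamma_z(s_\lambda)=z^{d(\lambda)}s_\lambda$, where $z^m=z_1^{m_1}\cdots z_k^{m_k}$. Its fixed-point algebra $C^*(\Lambda)^\gamma$ equals $\overline{\operatorname{span}}\{s_\lambda s_\mu^*:d(\lambda)=d(\mu)\}$. AF means approximately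 finite-dimensional: the closure of an increasing (directed) union of finite-dimensional $C^*$-subalgebras. *)

(* Defs.v *)
From HB Require Import structures.
From mathcomp Require Import all_boot all_order all_algebra.
From mathcomp Require Import complex finmap.
From mathcomp Require Import all_classical all_reals all_analysis.

Set Implicit Arguments.
Unset Strict Implicit.
Unset Printing Implicit Defensive.

Import Order.TTheory GRing.Theory Num.Theory.
Import numFieldNormedType.Exports.

Local Open Scope classical_set_scope.
Local Open Scope ring_scope.

(* C*-algebras are not assumed unital, hence do not inherit from [pzRingType];
   the zero algebra is allowed. *)
HB.mixin Record isCStarAlgebra (R : realType) A
    & CompleteNormedModule R[i] A := {
  cmul : A -> A -> A;
  star : A -> A;
  cmulA : associative cmul;
  cmulDl : left_distributive cmul +%R;
  cmulDr : right_distributive cmul +%R;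
  cmulZl : forall (c : R[i]) (a b : A), cmul (c *: a) b = c *: cmul a b;
  cmulZr : forall (c : R[i]) (a b : A), cmul a (c *: b) = c *: cmul a b;
  starK : involutive star;
  starD : {morph star : a b / a + b};
  starZ : forall (c : R[i]) (a : A), star (c *: a) = c^* *: star a;
  starM : forall a b : A, star (cmul a b) = cmul (star b) (star a);
  norm_cmul : forall a b : A, `|cmul a b| <= `|a| * `|b|;
  norm_star : forall a : A, `|cmul (star a) a| = `|a| ^+ 2
}.

#[short(type="cstarAlgType")]
HB.structure Definition CStarAlgebra (R : realType) :=
  {A of isCStarAlgebra R A & CompleteNormedModule R[i] A}.

Notation "a ** b" := (cmul a b) (at level 40, left associativity) : ring_scope.

Section CStarNotions.
Variable R : realType.

Record star_hom (A B : cstarAlgType R) (f : A -> B) : Prop := StarHom {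
  star_hom_linear : linear f;
  star_homM : forall a b, f (a ** b) = f a ** f b;
  star_homS : forall a, f (star a) = star (f a)
}.

Variable A : cstarAlgType R.

Record star_subalgebra (S : set A) : Prop := StarSubalgebra {
  star_subalgebra0 : S 0;
  star_subalgebraZD : forall (c : R[i]) a b, S a -> S b -> S (c *: a + b);
  star_subalgebraM : forall a b, S a -> S b -> S (a ** b);
  star_subalgebraS : forall a, S a -> S (star a)
}.

Definition cstar_subalgebra (S : set A) : Prop :=
  star_subalgebra S /\ closed S.

Definition generates (I : Type) (x : I -> A) : Prop :=
  forall S : set A, cstar_subalgebra S -> (forall i, S (x i)) -> S = setT.

Definition finite_dimensional (S : set A) : Prop :=
  exists (n : nat) (e : 'I_n -> A),
    S = range (fun c : 'I_n -> R[i] => \sum_(i < n) c i *: e i).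

Definition AF (S : set A) : Prop :=
  cstar_subalgebra S /\
  exists F : set (set A),
    [/\ F !=set0,
        (forall D, F D -> [/\ cstar_subalgebra D, finite_dimensional D
                            & D `<=` S]),
        (forall D1 D2, F D1 -> F D2 ->
           exists D, [/\ F D, D1 `<=` D & D2 `<=` D])
      & S = closure (\bigcup_(D in F) D)].

Definition projection (p : A) : Prop := star p = p /\ p ** p = p.

Definition partial_isometry (x : A) : Prop := x ** star x ** x = x.

End CStarNotions.

Notation degree k := {ffun 'I_k -> nat}.

Definition degree_join k (m n : degree k) : degree k :=
  [ffun i => maxn (m i) (n i)].

(* The factorisation property identifies vertices with the paths of degree 0
   via [kid].  [kcomp l m] is meaningful only when [src l = rng m]; its values
   elsewhere are unspecified. *)
Record kgraph (k : nat) := KGraph {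
  vertex : countType;
  kpath : countType;
  src : kpath -> vertex;
  rng : kpath -> vertex;
  kid : vertex -> kpath;
  kcomp : kpath -> kpath -> kpath;
  deg : kpath -> degree k;
  src_kid : forall v, src (kid v) = v;
  rng_kid : forall v, rng (kid v) = v;
  src_kcomp : forall l m, src l = rng m -> src (kcomp l m) = src m;
  rng_kcomp : forall l m, src l = rng m -> rng (kcomp l m) = rng l;
  kcomp_kidl : forall l, kcomp (kid (rng l)) l = l;
  kcomp_kidr : forall l, kcomp l (kid (src l)) = l;
  kcompA : forall l m n, src l = rng m -> src m = rng n ->
    kcomp l (kcomp m n) = kcomp (kcomp l m) n;
  deg_kid : forall v, deg (kid v) = 0;
  deg_kcomp : forall l m, src l = rng m -> deg (kcomp l m) = deg l + deg m;
  factorisation : forall l (m n : degree k), deg l = m + n ->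
    exists! p : kpath * kpath,
      [/\ deg p.1 = m, deg p.2 = n, src p.1 = rng p.2 & l = kcomp p.1 p.2]
}.

Section KGraphNotions.
Variables (k : nat) (L : kgraph k).

Definition Lmin (l m : kpath L) : set (kpath L * kpath L) :=
  [set ab | [/\ src l = rng ab.1, src m = rng ab.2,
                kcomp l ab.1 = kcomp m ab.2
              & deg (kcomp l ab.1) = degree_join (deg l) (deg m)]].

Definition finitely_aligned : Prop := forall l m, finite_set (Lmin l m).

Definition exhaustive (v : vertex L) (E : set (kpath L)) : Prop :=
  E `<=` [set l | rng l = v] /\
  forall m, rng m = v -> exists2 l, E l & Lmin l m !=set0.

End KGraphNotions.

(* In [CK_product] the factors commute by [CK_min], so the order in which [E]
   is enumerated is irrelevant; the product is taken in the corner with unit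
   [t (kid v)], and an exhaustive [E] is never empty.  The sum in [CK_min] is
   meant for finitely aligned graphs, where it is finite. *)
Record CK_family (R : realType) (k : nat) (L : kgraph k) (A : cstarAlgType R)
    (t : kpath L -> A) : Prop := CKFamily {
  CK_pisom : forall l, partial_isometry (t l);
  CK_proj : forall v, projection (t (kid v));
  CK_orth : forall v w, v <> w -> t (kid v) ** t (kid w) = 0;
  CK_comp : forall l m, src l = rng m -> t l ** t m = t (kcomp l m);
  CK_min : forall l m,
    star (t l) ** t m = \sum_(ab \in Lmin l m) t ab.1 ** star (t ab.2);
  CK_product : forall (v : vertex L) (E : {fset kpath L}),
    exhaustive v [set` E] ->
    \big[cmul/t (kid v)]_(l <- E) (t (kid v) - t l ** star (t l)) = 0
}.

Record graph_calg (R : realType) (k : nat) (L : kgraph k) := GraphCAlg {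
  gc_alg :> cstarAlgType R;
  gc_gen : kpath L -> gc_alg;
  gc_CK : CK_family gc_gen;
  gc_generates : generates gc_gen;
  gc_univ : forall (B : cstarAlgType R) (t : kpath L -> B), CK_family t ->
    exists! f : gc_alg -> B, star_hom f /\ forall l, f (gc_gen l) = t l
}.
Arguments gc_gen {R k L} _ _.

Section Representation.
Variables (R : realType) (k : nat) (L : kgraph k) (U : graph_calg R L).
Variables (B : cstarAlgType R) (t : kpath L -> B) (tCK : CK_family t).

Definition gc_rep : U -> B := projT1 (cid (gc_univ U tCK)).

Lemma gc_rep_hom : star_hom gc_rep.
Proof. by rewrite /gc_rep; case: cid => f [[]]. Qed.

Lemma gc_repE l : gc_rep (gc_gen U l) = t l.
Proof. by rewrite /gc_rep; case: cid => f [[]]. Qed.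

End Representation.
Arguments gc_rep {R k L} U {B t} tCK _.

Section Torus.
Variables (R : realType) (k : nat).

Definition torus : Type := {z : 'I_k -> R[i] | forall i, `|z i| = 1}.

Definition zpow (z : torus) (m : degree k) : R[i] :=
  \prod_(i < k) sval z i ^+ m i.

Lemma zpow0 z : zpow z 0 = 1.
Proof. by rewrite /zpow big1 // => i _; rewrite ffunE expr0. Qed.

Lemma zpowD z m n : zpow z (m + n) = zpow z m * zpow z n.
Proof.
by rewrite /zpow -big_split; apply: eq_bigr => i _ /=; rewrite ffunE exprD.
Qed.

Lemma norm_zpow z m : `|zpow z m| = 1.
Proof.
rewrite /zpow normr_prod big1 // => i _.
by rewrite normrX (svalP z) expr1n.
Qed.

Lemma zpow_neq0 z m : zpow z m != 0.
Proof. by rewrite -normr_eq0 norm_zpow oner_eq0. Qed.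

Lemma zpow_conj z m : (zpow z m)^* = (zpow z m)^-1.
Proof. by rewrite invC_norm norm_zpow expr1n invr1 mul1r. Qed.

Variables (L : kgraph k) (A : cstarAlgType R).

Lemma cmul_conj (z : torus) m (a b : A) :
  (zpow z m *: a) ** star (zpow z m *: b) = a ** star b.
Proof. by rewrite starZ cmulZl cmulZr scalerA zpow_conj mulfV ?scale1r // zpow_neq0. Qed.

Lemma fsbig_scaler (T : choiceType) (D : set T) (c : R[i]) (F : T -> A) :
  c != 0 -> \sum_(x \in D) (c *: F x) = c *: \sum_(x \in D) F x.
Proof.
move=> c0; rewrite scaler_sumr.
suff -> : finite_support 0 D (fun x => c *: F x) = finite_support 0 D F by [].
rewrite /finite_support !unlock.
suff -> : (fun x => c *: F x) @^-1` [set~ 0] = F @^-1` [set~ 0] by [].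
apply/seteqP; split=> x /= Fx F0; apply: Fx; first by rewrite F0 scaler0.
by apply/eqP; move/eqP: F0; rewrite scaler_eq0 (negPf c0).
Qed.

Lemma CK_gauge (t : kpath L -> A) (z : torus) :
  CK_family t -> CK_family (fun l => zpow z (deg l) *: t l).
Proof.
case=> tP tv tvw tM tmin tE.
have tid v : zpow z (deg (kid v)) *: t (@kid _ L v) = t (kid v).
  by rewrite deg_kid zpow0 scale1r.
split.
- by move=> l; rewrite /partial_isometry cmul_conj cmulZr tP.
- by move=> v; rewrite tid.
- by move=> v w; rewrite !tid; exact: tvw.
- by move=> l m lm; rewrite cmulZl cmulZr tM // scalerA deg_kcomp // zpowD.
- move=> l m; rewrite starZ cmulZl cmulZr tmin scalerA -fsbig_scaler; last first.
    by rewrite mulf_neq0 ?conjC_eq0 ?zpow_neq0.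
  apply: eq_fsbigr => -[a b]; rewrite inE => -[/= la mb lamb _].
  rewrite starZ cmulZl cmulZr scalerA; congr (_ *: _).
  have := congr1 (fun l => zpow z (deg l)) lamb.
  rewrite !deg_kcomp // !zpowD !zpow_conj => eab.
  apply: (mulfI (zpow_neq0 z (deg l))); apply: (mulIf (zpow_neq0 z (deg b))).
  by rewrite mulVKf ?zpow_neq0 // -[RHS]mulrA mulfVK ?zpow_neq0.
- move=> v E vE; rewrite tid -[RHS](tE v E vE).
  by apply: eq_bigr => l _; rewrite cmul_conj.
Qed.

End Torus.
Arguments torus : clear implicits.

Section Gauge.
Variables (R : realType) (k : nat) (L : kgraph k) (U : graph_calg R L).

(* The gauge automorphism of z is the homomorphism induced, through the
   universal property, by the Cuntz-Krieger family l |-> z^(deg l) s_l. *)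
Definition gauge (z : torus R k) : U -> U :=
  gc_rep U (CK_gauge z (gc_CK U)).

Lemma gauge_hom z : star_hom (gauge z).
Proof. exact: gc_rep_hom. Qed.

Lemma gaugeE z l : gauge z (gc_gen U l) = zpow z (deg l) *: gc_gen U l.
Proof. exact: gc_repE. Qed.

Lemma gauge_unique z (f : U -> U) : star_hom f ->
  (forall l, f (gc_gen U l) = zpow z (deg l) *: gc_gen U l) -> f = gauge z.
Proof.
move=> fh fE; have [g [_ gU]] := gc_univ U (CK_gauge z (gc_CK U)).
by rewrite -(gU f) // -(gU (gauge z)) //; split; [exact: gauge_hom|exact: gaugeE].
Qed.

Definition gauge_fixed : set U := [set a | forall z, gauge z a = a].

End Gauge.
Arguments gauge_fixed {R k L} U.

(* Main.v *)
(* The fixed-point algebra is the closure of the linear span of the monomials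
   [s_l s_m^*] with [deg l = deg m].  Every finite set of paths lies in a finite
   set H that contains the minimal common extensions of its elements and is
   stable under replacing an initial segment in H by another one of the same
   degree and source; the monomials over H then span a finite-dimensional
   *-subalgebra, and these subalgebras are directed.

   A homomorphism induced by a family with nonzero vertex projections is
   injective on each of these spans: with [T] the proper extensions of [l] in H
   and [q = prod_(x in T) (t_v - t_x t_x^* )], compressing an element of the
   kernel with [s_l q] and [s_m q] isolates the coefficient [c] of [s_l s_m^*]
   among the monomials of least degree.  Either [c = 0], or [q = 0], in which
   case [T] is exhaustive (a path missing every element of [T] would be fixed by
   [q]), so [q = 0] in C*(L) as well and [s_l s_m^*] is a combination of
   monomials of higher degree.  Induct on the degree.

   Norms need no spectral theory.  If [a] is self-adjoint with [|a| < 1], some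
   self-adjoint [h] commuting with [a] satisfies [a^2 + h^2 = 2h] (a contraction
   has a fixed point), that is, [a + i(1 - h)] is unitary in the unitization;
   this passes to images, whence homomorphisms are contractive.  Applied to the
   inverse on a finite-dimensional subalgebra, injectivity gives isometry, which
   survives passing to the closure. *)
From mathcomp Require Import all_boot all_order all_algebra.
From mathcomp Require Import complex finmap.
From mathcomp Require Import all_classical all_reals all_analysis.
From mathcomp Require Import ring lra zify.
Require Import Defs.
Set Implicit Arguments.
Unset Strict Implicit.
Unset Printing Implicit Defensive.
Import Order.TTheory GRing.Theory Num.Theory.
Import numFieldNormedType.Exports.
Local Open Scope classical_set_scope.
Local Open Scope ring_scope.

(** * Real-valued norms *)

Local Open Scope complex_scope.

Lemma ge0_ReE (R : realType) (c : R[i]) : 0 <= c -> c = (complex.Re c)%:C.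
Proof. by case: c => x y; rewrite lecE /= => /andP[/eqP -> _]. Qed.

Section RealNorm.
Variables (R : realType) (A : normedModType R[i]).
Implicit Types a b : A.

(** Norms take values in [R[i]]; passing to real parts moves all estimates into the totally ordered
    field [R]. *)
Definition rnorm a : R := complex.Re `|a|.

Lemma rnormE a : `|a| = (rnorm a)%:C.
Proof. exact/ge0_ReE/normr_ge0. Qed.

Lemma rnorm_ge0 a : 0 <= rnorm a.
Proof. by have := normr_ge0 a; rewrite rnormE -[0]/(0%:C) lecR. Qed.

Lemma rnorm0 : rnorm 0 = 0.
Proof. by rewrite /rnorm normr0. Qed.

Lemma rnorm_eq0 a : (rnorm a == 0) = (a == 0).
Proof. by rewrite -(normr_eq0 a) rnormE eq_complex /= eqxx andbT. Qed.

Lemma rnormN a : rnorm (- a) = rnorm a.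
Proof. by rewrite /rnorm normrN. Qed.

Lemma rnormB a b : rnorm (a - b) = rnorm (b - a).
Proof. by rewrite -rnormN opprB. Qed.

Lemma rnormD a b : rnorm (a + b) <= rnorm a + rnorm b.
Proof. by rewrite -lecR rmorphD /= -!rnormE ler_normD. Qed.

Lemma rnormZ (c : R[i]) a : rnorm (c *: a) = complex.Re `|c| * rnorm a.
Proof.
apply: (@complexI R); rewrite -rnormE normrZ rmorphM /= rnormE; congr (_ * _).
Qed.

Lemma closure_rnormP (S : set A) a :
  closure S a <-> forall e : R, 0 < e -> exists2 b, S b & rnorm (a - b) < e.
Proof.
split=> [cS e e0|cS B /nbhs_ballP[e /= e0 eB]].
  have /cS[b [Sb]] : nbhs a (ball a e%:C) by apply: nbhsx_ballx; rewrite ltcR.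
  by rewrite -ball_normE /= rnormE ltcR => ?; exists b.
have ee := ge0_ReE (ltW e0).
have [|b Sb ab] := cS (complex.Re e); first by rewrite -ltcR -ee.
exists b; split=> //; apply: eB.
by rewrite -ball_normE /= rnormE ee ltcR.
Qed.

Lemma closed_rnormP (S : set A) :
  (forall a, (forall e : R, 0 < e -> exists2 b, S b & rnorm (a - b) < e) -> S a) ->
  closed S.
Proof. by move=> cS a /closure_rnormP/cS. Qed.

End RealNorm.

Lemma norm_cauchy_seq (K : numFieldType) (V : completeNormedModType K)
    (u : nat -> V) :
  (forall e : K, 0 < e -> exists N, forall n, (N <= n)%N -> `|u N - u n| < e) ->
  exists l, forall e : K, 0 < e ->
    exists N, forall n, (N <= n)%N -> `|l - u n| < e.
Proof.
move=> uC; have : cauchy (u @ \oo).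
  apply: cauchy_exP => e e0; have [N uN] := uC e e0.
  by exists (u N); rewrite -ball_normE; exists N.
move/cauchy_cvgP/cvg_ex => [l /cvgrPdist_lt ul]; exists l => e e0.
by have [N _ lN] := ul e e0; exists N.
Qed.

Lemma rnorm_cauchy_seq (R : realType) (A : completeNormedModType R[i])
    (u : nat -> A) :
  (forall e : R, 0 < e -> exists N, forall n, (N <= n)%N -> rnorm (u N - u n) < e) ->
  exists l, forall e : R, 0 < e ->
    exists N, forall n, (N <= n)%N -> rnorm (l - u n) < e.
Proof.
move=> uC; have [e e0|l ul] := norm_cauchy_seq (u := u).
  have ee := ge0_ReE (ltW e0).
  have [|N uN] := uC (complex.Re e); first by rewrite -ltcR -ee.
  by exists N => n /uN; rewrite ee rnormE ltcR.
exists l => e e0; have [|N lN] := ul e%:C; first by rewrite ltcR.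
by exists N => n /lN; rewrite rnormE ltcR.
Qed.

(** * Finite-dimensional subspaces are closed *)

Lemma eventually_invn (R : realType) (e : R) : 0 < e ->
  exists N, forall n, (N <= n)%N -> n.+1%:R^-1 < e.
Proof.
move=> e0; have [N _ Ne] := near_infty_natSinv_lt (PosNum e0).
by exists N => n /Ne.
Qed.

Lemma complex_cauchy_seq (R : realType) (c : nat -> R[i]) :
  (forall e : R, 0 < e -> exists N, forall n, (N <= n)%N -> `|c N - c n| < e%:C) ->
  exists z, forall e : R, 0 < e ->
    exists N, forall n, (N <= n)%N -> `|z - c n| < e%:C.
Proof.
move=> cC.
have cvg_part (f : R[i] -> R) (fB : {morph f : x y / x - y}) :
    (forall z, `|f z|%:C <= `|z|) ->
    exists l, forall e, 0 < e ->
      exists N, forall n, (N <= n)%N -> `|l - f (c n)| < e.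
  move=> fle; apply: norm_cauchy_seq => e /cC[N cN]; exists N => n /cN cNn.
  by rewrite -fB -ltcR (le_lt_trans (fle _)).
have ReB : {morph @complex.Re R : x y / x - y} by move=> [? ?] [? ?].
have ImB : {morph @complex.Im R : x y / x - y} by move=> [? ?] [? ?].
have [x xc] := cvg_part _ ReB (@normc_ge_Re _).
have i1 : `|'i%C : R[i]| = 1 by rewrite normc_def /= expr0n add0r expr1n sqrtr1.
have Im_le (z : R[i]) : `|complex.Im z|%:C <= `|z|.
  (* The real part of [z i] is minus the imaginary part of [z]. *)
  have := normc_ge_Re (z * 'i%C); rewrite normrM i1 mulr1.
  by case: z => u v /=; rewrite mulr0 mulr1 sub0r normrN.
have [y yc] := cvg_part _ ImB Im_le.
exists (x +i* y) => e e0; have e20 : 0 < e / 2 by rewrite divr_gt0.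
have [M Mx] := xc _ e20; have [N Ny] := yc _ e20; exists (maxn M N) => n.
rewrite geq_max => /andP[/Mx xn /Ny yn].
have : (`|x - complex.Re (c n)| + `|y - complex.Im (c n)|)%:C < e%:C.
  by rewrite ltcR [e]splitr ltrD.
apply: le_lt_trans; case: (c n) => u v /=.
rewrite [X in `|X|]complexE (le_trans (ler_normD _ _)) // normrM i1 mul1r.
by rewrite !normc_def /= !expr0n !addr0 !sqrtr_sqr -rmorphD.
Qed.

Section FiniteDimensional.
Variables (R : realType) (A : normedModType R[i]).

(** If [v] is outside [F], its distance [d] from [F] is positive and [d |c| <= |c v - f|]. So the
    coefficients of [v] along a convergent sequence are Cauchy, and closedness of [F] settles the
    rest. *)
Lemma closed_addline (F : set A) (v : A) :
  (forall (c : R[i]) a b, F a -> F b -> F (c *: a + b)) -> F !=set0 ->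
  closed F -> closed [set a | exists c, F (a - c *: v)].
Proof.
move=> Flin [f0 Ff0] cF.
have F0 : F 0 by have := Flin (-1) _ _ Ff0 Ff0; rewrite scaleN1r addNr.
have FZ c a : F a -> F (c *: a) by move=> /(Flin c)/(_ F0); rewrite addr0.
have [Fv|nFv] := pselect (F v).
  rewrite (_ : [set _ | _] = F) //; apply/seteqP; split=> a /=.
    by move=> [c] /(Flin c _ _ Fv); rewrite addrC subrK.
  by exists 0; rewrite scale0r subr0.
have [d d0 vd] : exists2 d : R, 0 < d & forall f, F f -> d <= rnorm (v - f).
  apply: contrapT => nd; apply/nFv/cF/closure_rnormP => e e0.
  apply: contrapT => ne; apply: nd; exists e => // f Ff.
  by rewrite leNgt; apply/negP => fe; apply: ne; exists f.
have dc c f : F f -> d * complex.Re `|c| <= rnorm (c *: v - f).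
  move=> Ff; have [->|c0] := eqVneq c 0; first by rewrite normr0 mulr0 rnorm_ge0.
  rewrite -[f](scalerKV c0) -scalerBr rnormZ mulrC ler_wpM2l //; last exact/vd/FZ.
  by rewrite -(lecR 0) -ge0_ReE ?normr_ge0.
apply: closed_rnormP => a aF.
have /choice[w wP] n : exists cb, F (cb.2 - cb.1 *: v) /\
    rnorm (a - cb.2) < n.+1%:R^-1.
  have [|b [c Fb] ab] := aF n.+1%:R^-1; first by rewrite invr_gt0.
  by exists (c, b).
have [e e0|z zP] := complex_cauchy_seq (c := fun n => (w n).1).
  (* Two approximants within [e d / 2] of [a] have coefficients of [v] within [e] of each other. *)
  have [N NP] := eventually_invn (divr_gt0 (mulr_gt0 e0 d0) (ltr0Sn R 1)).
  exists N => n Nn.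
  have [FN aN] := wP N; have [Fn an] := wP n.
  have FNn := Flin (-1) _ _ FN Fn.
  rewrite (ge0_ReE (normr_ge0 _)) ltcR -(ltr_pM2l d0) [d * e]mulrC.
  rewrite (le_lt_trans (dc _ _ FNn)) //.
  have -> : ((w N).1 - (w n).1) *: v -
      (-1 *: ((w N).2 - (w N).1 *: v) + ((w n).2 - (w n).1 *: v)) =
      (a - (w n).2) - (a - (w N).2).
    rewrite scalerBl scaleN1r opprD opprK opprB addrACA [_ + (_ - _)]addrC subrK.
    by rewrite addKr opprB [RHS]addrC addrA subrK.
  rewrite (le_lt_trans (rnormD _ _)) // rnormN [ltRHS]splitr.
  by apply: ltrD; [exact: lt_trans an (NP _ _)|exact: lt_trans aN (NP _ _)].
exists z; apply/cF/closure_rnormP => e e0.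
have v0 : 0 < rnorm v.
  rewrite lt_def rnorm_ge0 andbT rnorm_eq0; apply/eqP => v0.
  by apply: nFv; rewrite v0.
have e20 : 0 < e / 2 by rewrite divr_gt0.
have [M MP] := eventually_invn e20; have [N NP] := zP _ (divr_gt0 e20 v0).
set n := maxn M N; have [Fn an] := wP n.
exists ((w n).2 - (w n).1 *: v) => //.
have -> : a - z *: v - ((w n).2 - (w n).1 *: v) =
    (a - (w n).2) - (z - (w n).1) *: v.
  by rewrite scalerBl !opprB addrACA [RHS]addrACA; congr (_ + _); exact: addrC.
rewrite (le_lt_trans (rnormD _ _)) // rnormN rnormZ [ltRHS]splitr ltrD //.
  by rewrite (lt_trans an) // MP // leq_maxl.
rewrite -ltr_pdivlMr // -ltcR -ge0_ReE // NP //.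
exact: leq_maxr.
Qed.
Lemma closed_span n (e : 'I_n -> A) :
  closed (range (fun c : 'I_n -> R[i] => \sum_(i < n) c i *: e i)).
Proof.
elim: n e => [|n IHn] e.
  rewrite (_ : range (fun c : 'I_0 -> R[i] => \sum_(i < 0) c i *: e i) = [set 0]).
    apply: closed_rnormP => a a0; apply/eqP.
    rewrite -rnorm_eq0 eq_le rnorm_ge0 andbT leNgt; apply/negP => /a0[b ->].
    by rewrite subr0 ltxx.
  apply/seteqP; split=> x /=; first by move=> [c _ <-]; rewrite big_ord0.
  by move=> ->; exists (fun=> 0) => //; rewrite big_ord0.
have := closed_addline (v := e ord0) _ _ (IHn (fun i => e (lift ord0 i))).
rewrite (_ : [set a | _] =
  range (fun c : 'I_n.+1 -> R[i] => \sum_(i < n.+1) c i *: e i)).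
  apply.
    move=> c _ _ [a _ <-] [b _ <-]; exists (fun i => c * a i + b i) => //.
    rewrite scaler_sumr -big_split; apply: eq_bigr => i _ /=.
    by rewrite scalerDl scalerA.
  by exists 0, (fun=> 0) => //; rewrite big1 // => i _; rewrite scale0r.
apply/seteqP; split=> x /=.
  move=> [c [b _ bx]].
  exists (fun i => if unlift ord0 i is Some j then b j else c) => //.
  rewrite big_ord_recl unlift_none.
  under eq_bigr do rewrite liftK.
  by rewrite bx addrC subrK.
move=> [c _ <-]; exists (c ord0); exists (fun i => c (lift ord0 i)) => //.
by rewrite [in RHS]big_ord_recl addrAC subrr add0r.
Qed.

End FiniteDimensional.

(** * Homomorphisms are contractive *)

Section CStarArithmetic.
Variables (R : realType) (A : cstarAlgType R).
Implicit Types (a b : A) (c : R[i]).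

Lemma cmul0l a : 0 ** a = 0.
Proof. by rewrite -{1}(scale0r (0 : A)) cmulZl scale0r. Qed.

Lemma cmul0r a : a ** 0 = 0.
Proof. by rewrite -{1}(scale0r (0 : A)) cmulZr scale0r. Qed.

Lemma cmulNl a b : (- a) ** b = - (a ** b).
Proof. by rewrite -scaleN1r cmulZl scaleN1r. Qed.

Lemma cmulNr a b : a ** (- b) = - (a ** b).
Proof. by rewrite -scaleN1r cmulZr scaleN1r. Qed.

Lemma cmulBl a b d : (a - b) ** d = a ** d - b ** d.
Proof. by rewrite cmulDl cmulNl. Qed.

Lemma cmulBr a b d : a ** (b - d) = a ** b - a ** d.
Proof. by rewrite cmulDr cmulNr. Qed.

Lemma star0 : star (0 : A) = 0.
Proof. by rewrite -(scale0r (0 : A)) starZ conjC0 !scale0r. Qed.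

Lemma starN a : star (- a) = - star a.
Proof. by rewrite -scaleN1r starZ rmorphN1 scaleN1r. Qed.

Lemma starB a b : star (a - b) = star a - star b.
Proof. by rewrite starD starN. Qed.

Lemma cmul_suml (I : Type) (s : seq I) (P : pred I) (F : I -> A) a :
  (\sum_(i <- s | P i) F i) ** a = \sum_(i <- s | P i) F i ** a.
Proof.
by apply: (big_morph (fun x => x ** a)) => [x y|]; rewrite ?cmulDl ?cmul0l.
Qed.

Lemma cmul_sumr (I : Type) (s : seq I) (P : pred I) (F : I -> A) a :
  a ** (\sum_(i <- s | P i) F i) = \sum_(i <- s | P i) a ** F i.
Proof.
by apply: (big_morph (fun x => a ** x)) => [x y|]; rewrite ?cmulDr ?cmul0r.
Qed.

Lemma rnormM a b : rnorm (a ** b) <= rnorm a * rnorm b.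
Proof. by rewrite -lecR rmorphM /= -!rnormE norm_cmul. Qed.

Lemma rnorm_starM a : rnorm (star a ** a) = rnorm a ^+ 2.
Proof.
by apply: (@complexI R); rewrite -rnormE norm_star rnormE rmorphXn.
Qed.

Lemma rnorm_star a : rnorm (star a) = rnorm a.
Proof.
have le_star b : rnorm b <= rnorm (star b).
  have [->|b0] := eqVneq (rnorm b) 0; first exact: rnorm_ge0.
  have bp : 0 < rnorm b by rewrite lt_def b0 rnorm_ge0.
  by rewrite -(ler_pM2r bp) -expr2 -rnorm_starM rnormM.
by apply/le_anti; rewrite le_star -{2}(starK a) le_star.
Qed.

Lemma star_mul_eq0 a : star a ** a = 0 -> a = 0.
Proof.
move=> aa; apply/eqP; rewrite -rnorm_eq0 -sqrf_eq0 -rnorm_starM aa.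
by rewrite rnorm0.
Qed.

Lemma mul_star_eq0 a : a ** star a = 0 -> a = 0.
Proof.
rewrite -{1}(starK a) => /star_mul_eq0; rewrite -{2}(starK a) => ->.
exact: star0.
Qed.

Lemma cstar_subalgebraS (S : set A) a : cstar_subalgebra S -> S a -> S (star a).
Proof. by case=> [[_ _ _ +] _]; apply. Qed.

Lemma cstar_subalgebraM (S : set A) a b :
  cstar_subalgebra S -> S a -> S b -> S (a ** b).
Proof. by case=> [[_ _ + _] _]; apply. Qed.

Lemma star_subalgebraZ (S : set A) c a : star_subalgebra S -> S a -> S (c *: a).
Proof. by case=> S0 SZ _ _ /(SZ c)/(_ S0); rewrite addr0. Qed.

Lemma star_subalgebraD (S : set A) a b :
  star_subalgebra S -> S a -> S b -> S (a + b).
Proof. by case=> _ SZ _ _ Sa /(SZ 1 _ _ Sa); rewrite scale1r. Qed.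

(** Serves to pass identities to limits; [C] collects the constants of the error terms. *)
Lemma rnorm_small_eq0 (C : R) a : (forall e, 0 < e -> rnorm a <= C * e) -> a = 0.
Proof.
move=> small; apply/eqP; rewrite -rnorm_eq0 eq_le rnorm_ge0 andbT.
have C0 : 0 <= C by have := small 1 ltr01; rewrite mulr1; apply: le_trans (rnorm_ge0 _).
apply/ler_addgt0Pl => e e0; rewrite addr0.
(* Dividing by [C + 1] instead of [C] covers [C = 0]. *)
have C1 : 0 < C + 1 by rewrite ltr_wpDl.
rewrite (le_trans (small _ (divr_gt0 e0 C1))) // mulrCA ger_pMr //.
by rewrite ler_pdivrMr // mul1r lerDl.
Qed.

End CStarArithmetic.

Section Contractive.
Variables (R : realType).

Lemma Re_norm_real (x : R) : 0 <= x -> complex.Re `|x%:C| = x.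
Proof. by move=> x0; rewrite ger0_norm // -[0]/(0%:C) lecR. Qed.

(* [1 - h] is a square root of [1 - a ** a] in the unitization. *)
Lemma exists_cosqrt (A : cstarAlgType R) (S : set A) (a : A) :
  cstar_subalgebra S -> S a -> star a = a -> rnorm a < 1 ->
  exists h, [/\ S h, star h = h, a ** h = h ** a & a ** a + h ** h = 2 *: h].
Proof.
move=> [Ssub Scl] Sa asa a1.
pose half : R[i] := (2^-1 : R)%:C.
have half2 : 2 * half = 1.
  by rewrite /half rmorphV ?unitfE //= rmorph_nat divff // pnatr_eq0.
(* The fixed points of [g] solve the last equation. The iterates from 0 stay in the ball of radius
   [rnorm a < 1], where [g] contracts by the factor [rnorm a]. Membership in [S], self-adjointness
   and commutation with [a] hold along the iteration and pass to the limit. *)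
pose g h := half *: (a ** a + h ** h).
have rhalf x : rnorm (half *: x) = 2^-1 * rnorm x :> R.
  by rewrite rnormZ Re_norm_real ?invr_ge0.
pose u n := iter n g 0.
have uP n : [/\ S (u n), star (u n) = u n, a ** u n = u n ** a
    & rnorm (u n) <= rnorm a].
  elim: n => [|n [Su su au nu]] /=.
    by rewrite star0 cmul0l cmul0r rnorm0 rnorm_ge0; split=> //; case: Ssub.
  rewrite /g -/(u n); split.
  - apply: star_subalgebraZ => //; apply: star_subalgebraD => //;
      by apply: star_subalgebraM.
  - by rewrite starZ starD !starM asa su conj_Creal // complex_real.
  - by rewrite cmulZl cmulZr cmulDl cmulDr !cmulA au -[u n ** a ** u n]cmulA au cmulA.
  - rewrite rhalf ler_pdivrMl // (le_trans (rnormD _ _)) //.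
    rewrite mulr_natl mulr2n lerD // (le_trans (rnormM _ _)) //.
      by rewrite ler_piMr ?rnorm_ge0 // ltW.
    by rewrite (le_trans (ler_pM _ _ nu nu)) ?rnorm_ge0 // ler_piMr ?rnorm_ge0 // ltW.
have sqB (x y : A) : x ** x - y ** y = x ** (x - y) + (x - y) ** y.
  by rewrite cmulBr cmulBl addrA subrK.
have uC m n : rnorm (u (m + n)%N - u m) <= rnorm a ^+ m.
  elim: m => [|m IH].
    by rewrite subr0 expr0; case: (uP n) => _ _ _ /le_trans -> //; exact: ltW.
  rewrite addSn /= /g -!/(u _) -scalerBr rhalf opprD addrACA subrr add0r sqB.
  rewrite ler_pdivrMl // (le_trans (rnormD _ _)) // mulr_natl mulr2n exprS.
  have [_ _ _ n1] := uP (m + n)%N; have [_ _ _ n2] := uP m.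
  rewrite lerD // (le_trans (rnormM _ _)) //; first by rewrite ler_pM ?rnorm_ge0.
  by rewrite mulrC ler_pM ?rnorm_ge0.
have [e e0|h hP] := @rnorm_cauchy_seq _ _ u.
  have : (GRing.exp (rnorm a) : nat -> R) @ \oo --> 0.
    by apply: cvg_expr; rewrite ger0_norm ?rnorm_ge0.
  move=> /cvgrPdist_lt/(_ e e0)[N _ NP]; exists N => n Nn.
  rewrite rnormB -(subnKC Nn) (le_lt_trans (uC _ _)) //.
  by have := NP N (leqnn N); rewrite sub0r normrN ger0_norm ?exprn_ge0 ?rnorm_ge0.
have hn e : 0 < e -> exists n, rnorm (h - u n) < e /\ rnorm (h - u n.+1) < e.
  by move=> /hP[N NP]; exists N; rewrite !NP.
exists h; split.
- apply/Scl/closure_rnormP => e /hn[n [ne _]]; exists (u n) => //.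
  by case: (uP n).
- apply/subr0_eq/(@rnorm_small_eq0 _ _ 2) => e /hn[n [ne _]].
  have [_ su _ _] := uP n.
  have -> : star h - h = star (h - u n) - (h - u n).
    by rewrite starB su opprB addrA subrK.
  rewrite (le_trans (rnormD _ _)) // rnormN rnorm_star mulr_natl mulr2n.
  by rewrite lerD // ltW.
- apply/subr0_eq/(@rnorm_small_eq0 _ _ 2) => e /hn[n [ne _]].
  have [_ _ au _] := uP n.
  have -> : a ** h - h ** a = a ** (h - u n) - (h - u n) ** a.
    by rewrite cmulBr cmulBl au opprB addrA subrK.
  rewrite (le_trans (rnormD _ _)) // rnormN mulr_natl mulr2n lerD //.
    rewrite (le_trans (rnormM _ _)) // -[e]mul1r.
    by rewrite ler_pM ?rnorm_ge0 // ltW.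
  rewrite (le_trans (rnormM _ _)) // -[e]mulr1.
  by rewrite ler_pM ?rnorm_ge0 // ltW.
(* [rnorm h] and 1 bound the outer factors of [h (h - u n) + (h - u n) u n]; the 2 comes from
   [2 *: (h - u n.+1)], as [a^2 + (u n)^2 = 2 u n.+1]. *)
- apply/subr0_eq/(@rnorm_small_eq0 _ _ (rnorm h + 1 + 2)) => e /hn[n [ne nSe]].
  have [_ _ _ un] := uP n.
  have -> : a ** a + h ** h - 2 *: h =
      (h ** h - u n ** u n) - 2 *: (h - u n.+1).
    rewrite scalerBr /= -/(u n) /g scalerA half2 scale1r opprB addrA; congr (_ - _).
    by rewrite addrACA addNr addr0 addrC.
  rewrite (le_trans (rnormD _ _)) // rnormN rnormZ mulrDl lerD //; last first.
    by rewrite ger0_norm // /= ler_wpM2l // ltW.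
  rewrite sqB (le_trans (rnormD _ _)) // mulrDl lerD // (le_trans (rnormM _ _)) //.
    by rewrite ler_wpM2l ?rnorm_ge0 // ltW.
  rewrite mulrC ler_pM ?rnorm_ge0 //; last exact: ltW.
  exact: le_trans un (ltW a1).
Qed.

(** Pythagoras for [c] equal to [i] or [-i]: the cross terms add up to [c (w^* d - d^* w) = 0]. *)
Lemma star_mul_skew (A : cstarAlgType R) (c : R[i]) (w d : A) :
  (c^*)%R = - c -> c ^+ 2 = -1 -> star w ** d = star d ** w ->
  star (w + c *: d) ** (w + c *: d) = star w ** w + star d ** d.
Proof.
move=> cN c2 wd; rewrite starD starZ cN scaleNr !cmulDl !cmulDr.
rewrite !cmulNl !cmulZl !cmulZr wd scalerA -expr2 c2 scaleN1r opprK.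
by rewrite addrA addrK.
Qed.

(** For [c = i] and [c = -i], [x + c (1 - y)] is unitary in the unitization. Only its action
    [b |-> x b + c (b - y b)], which is isometric, is written down. The two images of [b = x] add up
    to [2 x^2], whence [2 |x|^2 <= 2 |x|]. *)
Lemma ler_norm_cosqrt (A : cstarAlgType R) (x y : A) :
  star x = x -> star y = y -> x ** y = y ** x -> x ** x + y ** y = 2 *: y ->
  rnorm x <= 1.
Proof.
move=> sx sy xy xxyy.
have isom (c : R[i]) (b : A) : (c^*)%R = - c -> c ^+ 2 = -1 ->
    rnorm (x ** b + c *: (b - y ** b)) = rnorm b.
  move=> cN c2; apply/eqP; rewrite -(@eqrXn2 _ 2) ?rnorm_ge0 //.
  rewrite -!rnorm_starM star_mul_skew //; last first.
    rewrite starM starB starM sx sy cmulBr cmulBl !cmulA.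
    by rewrite -[star b ** x ** y]cmulA xy cmulA.
  rewrite starM starB starM sx sy cmulBl !cmulBr !cmulA.
  have -> : star b ** y ** y ** b = 2 *: (star b ** y ** b) - star b ** x ** x ** b.
    apply/eqP; rewrite eq_sym subr_eq eq_sym addrC; apply/eqP.
    have := congr1 (fun z => star b ** z ** b) xxyy.
    by rewrite /= cmulDr cmulDl cmulZr cmulZl !cmulA.
  have -> : star b ** y ** b - (2 *: (star b ** y ** b) - star b ** x ** x ** b)
      = star b ** x ** x ** b - star b ** y ** b.
    by rewrite scaler_nat mulr2n opprB opprD addrCA addNKr.
  by rewrite opprB subrKA addrC subrK.
have cfC : forall c : R[i], c ^+ 2 = -1 -> (c^*)%R = - c -> 2 *: (x ** x) =
    (x ** x + c *: (x - y ** x)) + (x ** x + (- c) *: (x - y ** x)).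
  by move=> c _ _; rewrite addrACA scaleNr subrr addr0 scaler_nat mulr2n.
have i2 : ('i%C : R[i]) ^+ 2 = -1 by exact: sqr_i.
have iC : (('i%C : R[i])^*)%R = - 'i%C by apply/eqP; rewrite eq_complex /= oppr0 !eqxx.
have : rnorm (2 *: (x ** x)) <= rnorm x + rnorm x.
  rewrite (cfC _ i2 iC) (le_trans (rnormD _ _)) // !isom ?sqrrN //.
  by rewrite rmorphN /= iC.
have -> : rnorm (2 *: (x ** x)) = 2 * rnorm x ^+ 2.
  by rewrite rnormZ -(rmorph_nat (real_complex R)) Re_norm_real // -{1}sx rnorm_starM.
rewrite -mulr2n -(mulr_natl (rnorm x)) ler_pM2l //.
have [->|x0] := eqVneq (rnorm x) 0; first by rewrite ler01.
by rewrite expr2 ger_pMl // lt_def x0 rnorm_ge0.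
Qed.

(** The relation of [exists_cosqrt] is algebraic, so [f] preserves it and [ler_norm_cosqrt] bounds
    the image; scaling and the C*-identity give all of [S]. The hypotheses on [f] are confined to
    [S] so that the inverse of an injective homomorphism qualifies. *)
Lemma hom_contractive (A B : cstarAlgType R) (S : set A) (f : A -> B) :
  cstar_subalgebra S ->
  (forall c a b, S a -> S b -> f (c *: a + b) = c *: f a + f b) ->
  (forall a b, S a -> S b -> f (a ** b) = f a ** f b) ->
  (forall a, S a -> f (star a) = star (f a)) ->
  forall a, S a -> rnorm (f a) <= rnorm a.
Proof.
move=> SS fL fM fS.
have Ssub := SS.1.
have S0 := star_subalgebra0 Ssub.
have f0 : f 0 = 0 by have := fL (-1) _ _ S0 S0; rewrite !scaleN1r !addNr.
have fZ c a : S a -> f (c *: a) = c *: f a.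
  by move=> Sa; have := fL c _ _ Sa S0; rewrite !addr0 f0 addr0.
have fD a b : S a -> S b -> f (a + b) = f a + f b.
  by move=> Sa Sb; have := fL 1 _ _ Sa Sb; rewrite !scale1r.
have unit_ball a : S a -> star a = a -> rnorm a < 1 -> rnorm (f a) <= 1.
  move=> Sa sa a1; have [h [Sh sh ah hE]] := exists_cosqrt SS Sa sa a1.
  apply: (@ler_norm_cosqrt _ _ (f h)); rewrite -?fS ?sa ?sh // -?fM ?ah //.
  by rewrite -fD ?hE ?fZ //; apply: cstar_subalgebraM.
have selfadj a : S a -> star a = a -> rnorm (f a) <= rnorm a.
  move=> Sa sa; apply/ler_addgt0Pl => e e0.
  have t0 : 0 < e + rnorm a by rewrite ltr_pwDl ?rnorm_ge0.
  (* Division by [t] puts [a] in the open unit ball, even when [a = 0]. *)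
  set t := e + rnorm a in t0 *.
  have Rt : complex.Re `|(t^-1)%:C| = t^-1 by rewrite Re_norm_real ?invr_ge0 ?ltW.
  have := @unit_ball ((t^-1)%:C *: a).
  rewrite fZ // !rnormZ Rt !ler_pdivrMl // ltr_pdivrMl // !mulr1; apply.
  - exact: star_subalgebraZ.
  - by rewrite starZ sa conj_Creal // complex_real.
  - by rewrite /t ltrDr.
move=> a Sa; rewrite -(@ler_pXn2r _ 2) ?nnegrE ?rnorm_ge0 // -!rnorm_starM.
have Ssa := cstar_subalgebraS SS Sa.
rewrite -fS // -fM //; apply: selfadj; first exact: cstar_subalgebraM.
by rewrite starM starK.
Qed.

Lemma star_hom_contractive (A B : cstarAlgType R) (f : A -> B) : star_hom f ->
  forall a, rnorm (f a) <= rnorm a.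
Proof.
move=> [fL fM fS] a; apply: (@hom_contractive _ _ setT) => // c b d _ _.
exact: fL.
Qed.

End Contractive.

Local Close Scope complex_scope.

(** * Finite sets of paths closed under matching *)

Section PathCalculus.
Variables (k : nat) (L : kgraph k).
Implicit Types (l m a b : kpath L) (p q : degree k).

(** Degrees are only partially ordered; this is the measure for the inductions on degree. *)
Definition total_degree p : nat := (\sum_(i < k) p i)%N.

Lemma total_degreeD p q : total_degree (p + q) = (total_degree p + total_degree q)%N.
Proof. by rewrite /total_degree -big_split; apply: eq_bigr => i _; rewrite ffunE. Qed.

Lemma total_degree_eq0 p : total_degree p = 0%N -> p = 0.
Proof.
move=> /eqP; rewrite sum_nat_eq0 => /forallP p0; apply/ffunP => i.
by rewrite ffunE; apply/eqP; exact: (implyP (p0 i)).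
Qed.

Lemma total_degree_le p q : (forall i, p i <= q i)%N -> (total_degree p <= total_degree q)%N.
Proof. by move=> pq; apply: leq_sum. Qed.

Lemma degree_addIl p q q' : p + q = p + q' -> q = q'.
Proof. by move=> /ffunP e; apply/ffunP => i; have := e i; rewrite !ffunE => /addnI. Qed.

Lemma degree_addIr p q q' : q + p = q' + p -> q = q'.
Proof. by rewrite ![_ + p]addrC => /degree_addIl. Qed.

Lemma degree_subnKC p q : (forall i, p i <= q i)%N -> exists q', q = p + q'.
Proof.
move=> pq; exists [ffun i => (q i - p i)%N]; apply/ffunP => i.
by rewrite !ffunE; apply/esym; exact: subnKC.
Qed.

Lemma kcomp_inj l a l' a' : src l = rng a -> src l' = rng a' -> deg l = deg l' ->
  kcomp l a = kcomp l' a' -> l = l' /\ a = a'.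
Proof.
move=> la la' dl e; have de := deg_kcomp la.
have [[u v] [_ uniq]] := factorisation de.
have e1 := uniq (l, a) (And4 (erefl _) (erefl _) la (erefl _)).
have da' : deg a' = deg a.
  by apply: (@degree_addIl (deg l)); rewrite -de e deg_kcomp // dl.
have e2 := uniq (l', a') (And4 (esym dl) da' la' e).
by move: e1; rewrite e2 => -[].
Qed.

Lemma kcomp_injr l a l' a' : src l = rng a -> src l' = rng a' -> deg a = deg a' ->
  kcomp l a = kcomp l' a' -> l = l' /\ a = a'.
Proof.
move=> la la' da e; apply: kcomp_inj => //; apply: (@degree_addIr (deg a)).
by rewrite -deg_kcomp // e deg_kcomp // da.
Qed.

(** The factorisations of [l] through [kid (src l)] and through [kid (rng l)] have the same degrees,
    hence coincide. *)
Lemma deg0_kid l : deg l = 0 -> l = kid (rng l).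
Proof.
by move=> l0; have [] := @kcomp_inj l (kid (src l)) (kid (rng l)) l;
  rewrite ?rng_kid ?src_kid ?deg_kid ?kcomp_kidr ?kcomp_kidl.
Qed.

Lemma kcomp_deg0 l a : src l = rng a -> deg a = 0 -> kcomp l a = l.
Proof. by move=> la /deg0_kid ->; rewrite -la kcomp_kidr. Qed.

Lemma factor_le l p : (forall i, p i <= deg l i)%N ->
  exists a b, [/\ src a = rng b, l = kcomp a b & deg a = p].
Proof.
move=> /degree_subnKC[q /factorisation[[a b] [[da _ ab lE] _]]].
by exists a, b.
Qed.

Lemma degree_le_kcomp l a : src l = rng a -> forall i, (deg l i <= deg (kcomp l a) i)%N.
Proof. by move=> la i; rewrite deg_kcomp // ffunE leq_addr. Qed.

(** Cut [l a] at degree [p], then the first piece at [deg l]; unique factorisation identifies the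
    initial segment with [l], so the cut at [p] runs through [a]. *)
Lemma factor_kcomp l a p : src l = rng a -> (forall i, deg l i <= p i)%N ->
  (forall i, p i <= deg (kcomp l a) i)%N ->
  exists b c, [/\ src l = rng b, src b = rng c, a = kcomp b c & deg (kcomp l b) = p].
Proof.
move=> la lp pla; have [z [c [zc e dz]]] := factor_le pla.
have [|u [b [ub zE du]]] := @factor_le z (deg l); first by rewrite dz.
have bc : src b = rng c by rewrite -zc zE src_kcomp.
have [||ul aE] := @kcomp_inj l a u (kcomp b c) la _ (esym du).
- by rewrite rng_kcomp.
- by rewrite e zE kcompA.
by exists b, c; rewrite ul; split=> //; rewrite -zE.
Qed.

(** A tail of [l] is determined by its degree, whose entries are at most [M]; [g] sends a degree to
    its tail, with the dummy value [l] where there is none. *)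
Lemma finite_tails l :
  finite_set [set b | exists2 a, src a = rng b & l = kcomp a b].
Proof.
pose M := total_degree (deg l).
pose tail (d : {ffun 'I_k -> 'I_M.+1}) b := (exists2 a, src a = rng b & l = kcomp a b)
  /\ forall i, deg b i = d i.
pose g d := if pselect (exists b, tail d b) is left e then projT1 (cid e) else l.
apply: (@sub_finite_set _ _ (range g)); last exact/finite_image/finite_finset.
move=> b [a ab lE].
have bM i : (deg b i < M.+1)%N.
  rewrite ltnS /M lE deg_kcomp // total_degreeD.
  rewrite (leq_trans _ (leq_addl _ _)) // /total_degree (bigD1 i) //=.
  exact: leq_addr.
pose d := [ffun i => Ordinal (bM i)].
have tb : tail d b by split; [exists a|move=> i; rewrite ffunE].
exists d => //; rewrite /g; case: pselect => [e|[]]; last by exists b.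
case: cid => b' /= [[a' ab' lE'] db'].
have [||||_ ->] // := @kcomp_injr a b a' b'; last by rewrite -lE.
  by apply/ffunP => i; rewrite db' ffunE.
Qed.

(** Designed for the product of [s_l s_m^*] and [s_x s_y^*]: the first clause puts the extension
    [m a = x b] in [H], the second then [l a] and [y b]. *)
Definition matching_closed (H : set (kpath L)) : Prop :=
  (forall l m ab, H l -> H m -> Lmin l m ab -> H (kcomp l ab.1)) /\
  (forall l m b, H l -> H m -> deg l = deg m -> src l = src m -> src m = rng b ->
     H (kcomp m b) -> H (kcomp l b)).

(* [H] absorbs minimal common extensions and replacements of initial segments
   only up to total degree [j]. *)
Definition truncated_closed (N : degree k) (j : nat) (H : set (kpath L)) : Prop :=
  [/\ finite_set H,
      forall l, H l -> (total_degree (deg l) < j)%N,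
      forall l, H l -> forall i, (deg l i <= N i)%N,
      forall l m ab, H l -> H m -> Lmin l m ab ->
        (total_degree (deg (kcomp l ab.1)) < j)%N -> H (kcomp l ab.1)
    & forall l m b, H l -> H m -> deg l = deg m -> src l = src m ->
        src m = rng b -> H (kcomp m b) -> H (kcomp l b)].

Lemma finite_pair_bigcup (T U V : Type) (H : set T) (G : set U) (F : T -> U -> set V) :
  finite_set H -> finite_set G -> (forall t u, finite_set (F t u)) ->
  finite_set [set v | exists t u, [/\ H t, G u & F t u v]].
Proof.
move=> Hf Gf Ff.
rewrite (_ : [set v | _] = \bigcup_(t in H) \bigcup_(u in G) F t u).
  by apply: bigcup_finite => // t _; apply: bigcup_finite.
apply/seteqP; split=> v /=.
  by move=> [t [u [Ht Gu Fv]]]; exists t => //; exists u.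
by move=> [t Ht [u Gu Fv]]; exists t, u.
Qed.

(** One new layer, of total degree [j], is added. It stays finite because one replacement of an
    initial segment is enough: two successive ones merge into one, after cutting at the minimal
    common extension of the segments involved. *)
Lemma truncated_closedS (N : degree k) j (E H : set (kpath L)) :
  finitely_aligned L -> finite_set E ->
  (forall l, E l -> forall i, (deg l i <= N i)%N) ->
  truncated_closed N j H ->
  exists2 H', truncated_closed N j.+1 H' &
    H `<=` H' /\ forall l, E l -> total_degree (deg l) = j -> H' l.
Proof.
move=> fa Ef EN [Hf Hj HN Ha Hb].
(* [X] holds what [E] and minimal common extensions force in total degree [j]; [Y] adds what one
   replacement of [s] by [t] in [H] yields. Letting [s] range over all paths is what allows
   replacements to be merged. *)
pose X : set (kpath L) := [set x | total_degree (deg x) = j] `&`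
  (E `|` [set x | exists l m, [/\ H l, H m & [set kcomp l ab.1 | ab in Lmin l m] x]]).
pose Y : set (kpath L) := X `|` [set y | exists t x, [/\ H t, X x &
  [set kcomp t b | b in [set b | [/\ src t = rng b &
     exists s, [/\ deg s = deg t, src s = src t & x = kcomp s b]]]] y]].
have Xf : finite_set X.
  apply: finite_setIr; rewrite finite_setU; split=> //.
  apply: finite_pair_bigcup => // l m; exact/finite_image/fa.
have Yf : finite_set Y.
  rewrite finite_setU; split=> //; apply: finite_pair_bigcup => // t x.
  apply/finite_image/(sub_finite_set _ (finite_tails x)).
  by move=> b /= [tb [s [_ st xE]]]; exists s; rewrite ?st.
have Yj y : Y y -> total_degree (deg y) = j.
  move=> [[]//|[t [x [Ht [xj _] [b /= [tb [s [st sst xE]]] <-]]]]].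
  by rewrite -xj xE !deg_kcomp ?st ?sst.
have XN x : X x -> forall i, (deg x i <= N i)%N.
  move=> [_ [/EN //|[l [m [/HN lN /HN mN [[a b] /= [_ _ _ ab] <-]]]]]] i.
  by rewrite ab ffunE geq_max lN mN.
have YN y : Y y -> forall i, (deg y i <= N i)%N.
  move=> [/XN //|[t [x [Ht /XN xN [b /= [tb [s [st sst xE]]] <-]]]]].
  by move=> i; have := xN i; rewrite xE !deg_kcomp ?st ?sst.
have Hlow l : (H `|` Y) l -> (total_degree (deg l) < j)%N -> H l.
  by move=> [//|/Yj ->]; rewrite ltnn.
exists (H `|` Y); last first.
  by split=> [l|l El lj]; [left|right; left; split=> //; left].
split.
- by rewrite finite_setU.
- by move=> l [/Hj/ltnW//|/Yj ->]; rewrite ltnS.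
- by move=> l [/HN|/YN].
- move=> l m [a b] HYl HYm ab /= dab; have [la mb e dE] := ab.
  move: la mb e dE => /= la mb e dE.
  (* Within the bound, a path of total degree [j] has only extensions by degree 0. *)
  have [lj|lj] := ltnP (total_degree (deg l)) j; last first.
    suff -> : kcomp l a = l by [].
    apply: kcomp_deg0 => //; apply: total_degree_eq0.
    by move: dab; rewrite deg_kcomp // total_degreeD; lia.
  have [mj|mj] := ltnP (total_degree (deg m)) j; last first.
    suff -> : kcomp l a = m by [].
    rewrite e; apply: kcomp_deg0 => //; apply: total_degree_eq0.
    by move: dab; rewrite e deg_kcomp // total_degreeD; lia.
  have Hl := Hlow _ HYl lj; have Hm := Hlow _ HYm mj.
  have [abj|abj] := ltnP (total_degree (deg (kcomp l a))) j.
    by left; exact: (Ha l m (a, b)).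
  right; left; split; first by apply/eqP; rewrite eqn_leq -ltnS dab abj.
  by right; exists l, m; split=> //; exists (a, b).
- move=> l m b HYl HYm lm slm mb HYmb.
  have [b0|b0] := eqVneq (total_degree (deg b)) 0%N.
    by rewrite kcomp_deg0 ?slm //; exact: total_degree_eq0.
  have mbj : (total_degree (deg (kcomp m b)) < j.+1)%N.
    by case: HYmb => [/Hj/ltnW//|/Yj ->].
  have mj : (total_degree (deg m) < j)%N.
    by move: mbj b0; rewrite deg_kcomp // total_degreeD; lia.
  have Hm := Hlow _ HYm mj; have Hl : H l by apply: Hlow; rewrite ?lm.
  have [Hmb|Ymb] := HYmb; first by left; exact: (Hb l m).
  right.
  have inX : X (kcomp m b) -> Y (kcomp l b).
    move=> Xmb; right; exists l, (kcomp m b); split=> //; exists b => //=.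
    by split; [rewrite slm|exists m].
  have mbjE := Yj _ Ymb.
  case: Ymb => [/inX//|[t [x [Ht Xx [b' [tb' [s [st sst xE]]] tbE]]]]].
  (* Here [m b = t b'] with [x = s b'] in [X]. If its degree is the join [p], then [m b] is a
     minimal common extension of [t] and [m], so it lies in [X]. Otherwise it is cut at [p]. *)
  set p := degree_join (deg t) (deg m).
  have [full|nfull] := eqVneq (deg (kcomp m b)) p.
    apply: inX; split=> //; right; exists t, m; split=> //.
    by exists (b', b) => //; split=> //=; rewrite tbE.
  have tp i : (deg t i <= p i)%N by rewrite ffunE leq_maxl.
  have mp i : (deg m i <= p i)%N by rewrite ffunE leq_maxr.
  have pmb i : (p i <= deg (kcomp m b) i)%N.
    by rewrite ffunE geq_max -{1}tbE !degree_le_kcomp.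
  have [|b1 [c [tb1 b1c b'E dz]]] := factor_kcomp tb' tp; first by rewrite tbE.
  have [m1 [c' [mm1 m1c' bE dz']]] := factor_kcomp mb mp pmb.
  have [||||zE cE] := @kcomp_inj (kcomp t b1) c (kcomp m m1) c'.
  - by rewrite src_kcomp.
  - by rewrite src_kcomp.
  - by rewrite dz dz'.
  - by rewrite -!kcompA // -b'E -bE.
  move: m1c' bE; rewrite -{}cE => m1c bE.
  (* The tail [c] beyond the cut is nontrivial, so the common extension [m m1 = t b1] lies in a
     lower layer, hence in [H]. *)
  have pj : (total_degree p < j)%N.
    have mbE : deg (kcomp m b) = p + deg c.
      by rewrite bE kcompA // deg_kcomp ?src_kcomp // dz'.
    have := mbjE; rewrite mbE total_degreeD.
    have : total_degree (deg c) != 0%N.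
      by apply/eqP => /total_degree_eq0 c0; move: nfull; rewrite mbE c0 addr0 eqxx.
    by lia.
  have Hz : H (kcomp m m1).
    by rewrite -zE; apply: (Ha t m (b1, m1)); rewrite //= dz.
  have Hlm1 := Hb _ _ _ Hl Hm lm slm mm1 Hz.
  (* The merged replacement: [l b = (l m1) c] comes from [x = (s b1) c] by exchanging [s b1] for
     [l m1]. *)
  right; exists (kcomp l m1), x; split=> //; exists c; last first.
    by rewrite bE kcompA // slm.
  split; first by rewrite src_kcomp ?slm.
  exists (kcomp s b1); split; last by rewrite xE b'E kcompA // sst.
    by rewrite !deg_kcomp ?sst ?slm // st lm -!deg_kcomp // dz dz'.
  by rewrite !src_kcomp ?sst ?slm // m1c.
Qed.

(** Neither operation leads to a degree beyond the join [N] of the degrees in [E], so truncation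
    above the total degree of [N] loses nothing. *)
Lemma matching_closure (E : set (kpath L)) : finitely_aligned L -> finite_set E ->
  exists H, [/\ finite_set H, E `<=` H & matching_closed H].
Proof.
move=> fa Ef.
pose N : degree k := [ffun i => (\max_(l <- fset_set E) deg l i)%N].
have EN l : E l -> forall i, (deg l i <= N i)%N.
  move=> El i; rewrite ffunE; apply: (@leq_bigmax_seq _ _ xpredT (fun l => deg l i)) => //.
  by rewrite in_fset_set // inE.
have [H HN EH] : exists2 H, truncated_closed N (total_degree N).+1 H &
    forall l, E l -> (total_degree (deg l) < (total_degree N).+1)%N -> H l.
  (* The layers start from the empty set, as no total degree is below 0. *)
  elim: _.+1 => [|j [H HN EH]].
    by exists set0 => //; split=> //; exact: finite_set0.
  have [H' H'N [HH' EH']] := truncated_closedS fa Ef EN HN.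
  exists H' => // l El; rewrite ltnS leq_eqVlt => /orP[/eqP/EH'|/EH/HH']; exact.
have [Hf Hj HleN Ha Hb] := HN.
exists H; split=> //.
  by move=> l El; apply: EH; rewrite // ltnS total_degree_le //; exact: EN.
split=> // l m ab Hl Hm lm; apply: (Ha l m) => //.
case: lm => _ _ _ ->; rewrite ltnS; apply: total_degree_le => i.
by rewrite ffunE geq_max !HleN.
Qed.

End PathCalculus.

(** * Linear spans *)

Definition linear_closed (R : realType) (A : cstarAlgType R) (S : set A) : Prop :=
  S 0 /\ forall (c : R[i]) a b, S a -> S b -> S (c *: a + b).

Section LinearSpan.
Variables (R : realType) (A : cstarAlgType R).
Implicit Types (G S : set A).

(** As an intersection of subspaces, the span comes with an induction principle, [lspan_sub];
    [lspan_imageE] recovers coefficients for finite families. *)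
Definition lspan G : set A :=
  [set x | forall S, linear_closed S -> G `<=` S -> S x].

Lemma lspan_closed G : linear_closed (lspan G).
Proof.
split=> [S [] //|c a b Ga Gb S SL GS].
by apply: (proj2 SL); [exact: Ga|exact: Gb].
Qed.

Lemma sub_lspan G : G `<=` lspan G. Proof. by move=> x Gx S _; apply. Qed.

Lemma lspan_sub G S : linear_closed S -> G `<=` S -> lspan G `<=` S.
Proof. by move=> SL GS x; apply. Qed.

Lemma lspanS G G' : G `<=` G' -> lspan G `<=` lspan G'.
Proof. by move=> GG; apply: lspan_sub; [exact: lspan_closed|move=> x /GG/sub_lspan]. Qed.

Lemma linear_closedD S a b : linear_closed S -> S a -> S b -> S (a + b).
Proof. by case=> _ SL Sa Sb; have := SL 1 _ _ Sa Sb; rewrite scale1r. Qed.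

Lemma linear_closedZ S c a : linear_closed S -> S a -> S (c *: a).
Proof. by case=> S0 SL Sa; have := SL c _ _ Sa S0; rewrite addr0. Qed.

Lemma linear_closedB S a b : linear_closed S -> S a -> S b -> S (a - b).
Proof. by case=> _ SL Sa Sb; have := SL (-1) _ _ Sb Sa; rewrite scaleN1r addrC. Qed.

Lemma linear_closed_sum (I : eqType) (s : seq I) S (F : I -> A) : linear_closed S ->
  (forall i, i \in s -> S (F i)) -> S (\sum_(i <- s) F i).
Proof.
move=> SL SF; rewrite big_seq; elim/big_ind: _ => //; first by case: SL.
by move=> x y; exact: linear_closedD.
Qed.

Lemma linear_closed_preim (B : cstarAlgType R) (T : set B) (f : A -> B) :
  (forall c a b, f (c *: a + b) = c *: f a + f b) -> linear_closed T ->
  linear_closed (f @^-1` T).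
Proof.
move=> fL [T0 TL]; split=> [|c a b Ta Tb] /=; last by rewrite fL; exact: TL.
suff -> : f 0 = 0 by [].
by have := fL (-1) 0 0; rewrite !scaleN1r !addNr.
Qed.

Lemma lspan_mulr G S b : linear_closed S -> (forall x, G x -> S (b ** x)) ->
  forall x, lspan G x -> S (b ** x).
Proof.
move=> SL GS; apply: (lspan_sub (S := (fun x => b ** x) @^-1` S)) => //.
by apply: linear_closed_preim => // c a d; rewrite cmulDr cmulZr.
Qed.

Lemma lspan_star_subalgebra G : (forall x, G x -> G (star x)) ->
  (forall x y, G x -> G y -> lspan G (x ** y)) -> star_subalgebra (lspan G).
Proof.
move=> GS GM; have [l0 lZD] := lspan_closed G; split=> //.
  move=> x y Gx; move: x Gx y; apply: lspan_sub => [|x Gx y].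
    split=> [y _|c a b Ha Hb y Gy]; first by rewrite cmul0l.
    by rewrite cmulDl cmulZl; apply: lZD; [exact: Ha|exact: Hb].
  by apply: lspan_mulr => [|z Gz]; [exact: lspan_closed|exact: GM].
apply: lspan_sub => [|x /GS/sub_lspan //].
by split=> [|c a b Ga Gb]; rewrite /= ?star0 // starD starZ; exact: lZD.
Qed.

Lemma lspan_imageE (I : choiceType) (P : set I) (F : I -> A) : finite_set P ->
  lspan (F @` P) = [set x | exists c : I -> R[i], x = \sum_(i <- fset_set P) c i *: F i].
Proof.
move=> Pf; apply/seteqP; split.
  apply: lspan_sub.
    split=> [|z a b [c ->] [d ->]].
      by exists (fun=> 0); rewrite big1 // => i _; rewrite scale0r.
    exists (fun i => z * c i + d i); rewrite scaler_sumr -big_split.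
    by apply: eq_bigr => i _ /=; rewrite scalerDl scalerA.
  move=> _ [j Pj <-]; exists (fun i => (i == j)%:R).
  rewrite (bigD1_seq j) ?fset_uniq ?in_fset_set ?inE //= eqxx scale1r.
  by rewrite big1 ?addr0 // => i /negPf ->; rewrite scale0r.
move=> x [c ->]; apply: (linear_closed_sum (S := lspan (F @` P))); first exact: lspan_closed.
move=> i; rewrite in_fset_set // inE => Pi.
apply: (linear_closedZ (S := lspan (F @` P))); first exact: lspan_closed.
by apply: (sub_lspan (G := F @` P)); exists i.
Qed.

Lemma lspan_finite_dimensional (I : choiceType) (P : set I) (F : I -> A) :
  finite_set P -> finite_dimensional (lspan (F @` P)).
Proof.
move=> Pf; rewrite lspan_imageE //; set s : seq I := fset_set P.
exists (size s), (fun i => F (tnth (in_tuple s) i)).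
apply/seteqP; split=> x /=.
  by move=> [c ->]; exists (fun i => c (tnth (in_tuple s) i)); rewrite // [RHS]big_tnth.
move=> [c _ <-].
(* Coefficients by position become a function on [I], with the dummy value 0 off [s]. *)
exists (fun j => if insub (index j s) is Some i then c i else 0).
rewrite [RHS]big_tnth; apply: eq_bigr => i _.
have -> : index (tnth (in_tuple s) i) s = i.
  by rewrite (tnth_nth (tnth (in_tuple s) i)) /= index_uniq ?fset_uniq.
by rewrite valK.
Qed.

Lemma finite_dimensional_closed S : finite_dimensional S -> closed S.
Proof. by move=> [n [e ->]]; exact: closed_span. Qed.

End LinearSpan.

(** * Calculus in a Cuntz-Krieger family *)

Section CKCalculus.
Variables (R : realType) (k : nat) (L : kgraph k) (A : cstarAlgType R).
Variables (t : kpath L -> A) (tCK : CK_family t) (L_fa : finitely_aligned L).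
Implicit Types (l m x : kpath L) (v : vertex L).

Lemma CK_minE l m :
  star (t l) ** t m = \sum_(ab <- fset_set (Lmin l m)) t ab.1 ** star (t ab.2).
Proof. by rewrite (CK_min tCK) fsbig_finite. Qed.

Lemma in_Lmin l m ab : (ab \in (fset_set (Lmin l m) : seq _)) -> Lmin l m ab.
Proof. by rewrite in_fset_set // inE. Qed.

Lemma CK_star_kid v : star (t (kid v)) = t (kid v).
Proof. by case: (CK_proj tCK v). Qed.

Lemma CK_kid_idem v : t (kid v) ** t (kid v) = t (kid v).
Proof. by case: (CK_proj tCK v). Qed.

Lemma CK_kidl l : t (kid (rng l)) ** t l = t l.
Proof. by rewrite (CK_comp tCK) ?src_kid // kcomp_kidl. Qed.

Lemma CK_kidr l : t l ** t (kid (src l)) = t l.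
Proof. by rewrite (CK_comp tCK) ?rng_kid // kcomp_kidr. Qed.

Lemma CK_starr l : star (t l) ** t (kid (rng l)) = star (t l).
Proof. by rewrite -{1}CK_star_kid -starM CK_kidl. Qed.

Lemma Lmin_same_degree l m ab : deg l = deg m -> Lmin l m ab ->
  l = m /\ ab = (kid (src l), kid (src l)).
Proof.
move=> lm; case: ab => a b [/= la mb e dE].
have [lE abE] := kcomp_inj la mb lm e.
have a0 : deg a = 0.
  apply: (@degree_addIl _ (deg l)); rewrite -deg_kcomp // dE addr0.
  by apply/ffunP => i; rewrite ffunE lm maxnn.
by split=> //; rewrite -abE (deg0_kid a0) la.
Qed.

Lemma CK_star_self l : star (t l) ** t l = t (kid (src l)).
Proof.
rewrite (CK_min tCK) (_ : Lmin l l = [set (kid (src l), kid (src l))]).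
  by rewrite fsbig_set1 CK_star_kid CK_kid_idem.
apply/seteqP; split=> ab; first by case/Lmin_same_degree.
move=> ->; split; rewrite //= ?rng_kid // kcomp_kidr.
by apply/ffunP => i; rewrite ffunE maxnn.
Qed.

Lemma CK_mul_star l m x y : src l = src m -> src x = src y ->
  t l ** star (t m) ** (t x ** star (t y)) =
  \sum_(ab <- fset_set (Lmin m x)) t (kcomp l ab.1) ** star (t (kcomp y ab.2)).
Proof.
move=> lm xy; rewrite cmulA -[t l ** _ ** _]cmulA CK_minE cmul_sumr cmul_suml.
rewrite big_seq [RHS]big_seq; apply: eq_bigr => -[a b] /in_Lmin[/= ma xb _ _].
rewrite -!(CK_comp tCK) ?lm -?xy // starM !cmulA.
by rewrite -[t l ** _ ** _ ** _]cmulA.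
Qed.

(** The threshold [j] filters the monomials by total degree: [j = 0] gives the whole core, and
    injectivity is proved by raising [j] past every degree in [H]. *)
Definition core_pairs (H : set (kpath L)) (j : nat) : set (kpath L * kpath L) :=
  [set lm | [/\ H lm.1, H lm.2, deg lm.1 = deg lm.2, src lm.1 = src lm.2
              & (j <= total_degree (deg lm.1))%N]].

Definition core (H : set (kpath L)) (j : nat) : set A :=
  lspan ((fun lm => t lm.1 ** star (t lm.2)) @` core_pairs H j).

Lemma finite_core_pairs H j : finite_set H -> finite_set (core_pairs H j).
Proof.
move=> Hf; apply: (@sub_finite_set _ _ (H `*` H)); last exact: finite_setX.
by move=> [l m] [].
Qed.

Lemma core_linear H j : linear_closed (core H j).
Proof. exact: lspan_closed. Qed.

Lemma core_mem H j l m : H l -> H m -> deg l = deg m -> src l = src m ->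
  (j <= total_degree (deg l))%N -> core H j (t l ** star (t m)).
Proof. by move=> *; apply: (sub_lspan (G := _ @` _)); exists (l, m). Qed.

Lemma Lmin_matched l m x y ab : deg l = deg m -> deg x = deg y ->
  src l = src m -> src x = src y -> Lmin m x ab ->
  [/\ src l = rng ab.1, src y = rng ab.2,
      deg (kcomp l ab.1) = deg (kcomp y ab.2),
      deg (kcomp l ab.1) = degree_join (deg m) (deg x)
    & src (kcomp l ab.1) = src (kcomp y ab.2)].
Proof.
case: ab => a b dlm dxy lm xy [/= ma xb e dE].
have la : src l = rng a by rewrite lm.
have yb : src y = rng b by rewrite -xy.
split=> //.
- by rewrite !deg_kcomp // dlm -dxy -!deg_kcomp // e.
- by rewrite deg_kcomp // dlm -deg_kcomp.
- by rewrite !src_kcomp // -(src_kcomp ma) e src_kcomp.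
Qed.

Lemma core_star_subalgebra H : matching_closed H -> star_subalgebra (core H 0).
Proof.
move=> [Ha Hb]; apply: lspan_star_subalgebra.
  move=> _ [[l m] [/= Hl Hm lm slm _] <-]; rewrite starM starK.
  by exists (m, l) => //; split.
move=> _ _ [[l m] [/= Hl Hm lm slm _] <-] [[x y] [/= Hx Hy xy sxy _] <-].
rewrite CK_mul_star //.
apply: (linear_closed_sum (S := core H 0)); first exact: core_linear.
move=> [a b] /in_Lmin ab; have [/= la yb dE _ sE] := Lmin_matched lm xy slm sxy ab.
have Hma := Ha _ _ _ Hm Hx ab; have [/= ma xb e _] := ab.
apply: core_mem => //; first exact: (Hb l m).
by apply: (Hb y x) => //; rewrite -e.
Qed.

Lemma core_cstar_subalgebra H : finite_set H -> matching_closed H ->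
  cstar_subalgebra (core H 0).
Proof.
move=> Hf Hc; split; first exact: core_star_subalgebra.
apply: finite_dimensional_closed; apply: lspan_finite_dimensional.
exact: finite_core_pairs.
Qed.

(* The corner projection [t_v - sup_(x in T) t_x t_x^*]. *)
Definition gap v (T : seq (kpath L)) : A :=
  \big[cmul/t (kid v)]_(x <- T) (t (kid v) - t x ** star (t x)).

Lemma gap_kidr v T : gap v T ** t (kid v) = gap v T.
Proof.
rewrite /gap; elim: T => [|x T IH]; first by rewrite big_nil CK_kid_idem.
by rewrite big_cons -cmulA IH.
Qed.

(** Without common extensions [t_x^* t_m] is an empty sum, so each factor of the gap fixes [t m]. *)
Lemma gap_fix v T m : rng m = v -> (forall x, x \in T -> Lmin x m = set0) ->
  gap v T ** t m = t m.
Proof.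
move=> mv; rewrite /gap; elim: T => [|x T IH] Tm; first by rewrite big_nil -mv CK_kidl.
rewrite big_cons -cmulA IH => [|y yT]; last by rewrite Tm // inE yT orbT.
rewrite cmulBl -mv CK_kidl -cmulA (CK_min tCK) Tm ?inE ?eqxx //.
by rewrite fsbig_set0 cmul0r subr0.
Qed.

(** Moves a range projection to the right of [t y]; this takes the place of commuting the factors of
    a gap. *)
Lemma range_proj_mul x y :
  t x ** star (t x) ** t y =
  t y ** (\sum_(ab <- fset_set (Lmin x y)) t ab.2 ** star (t ab.2)).
Proof.
rewrite -cmulA CK_minE !cmul_sumr big_seq [RHS]big_seq.
apply: eq_bigr => -[a b] /in_Lmin[/= xa yb e _].
by rewrite !cmulA !(CK_comp tCK) // e.
Qed.

Lemma gap_kill v T x : (forall y, y \in T -> rng y = v) -> x \in T ->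
  gap v T ** t x = 0.
Proof.
rewrite /gap => Tv xT; have xv := Tv _ xT.
elim: T xT Tv => // y T IH; rewrite inE big_cons -cmulA => xT Tv.
(* Reduces to the last occurrence of [x] in the list. *)
have [xT'|xT'] := boolP (x \in T).
  by rewrite IH ?cmul0r // => z zT; apply: Tv; rewrite inE zT orbT.
have -> : x = y by move: xT; rewrite (negPf xT') orbF => /eqP.
have yv : rng y = v by apply: Tv; rewrite inE eqxx.
(* The later factors move through [t y], leaving [t y] next to the factor that annihilates it. *)
have [w ->] : exists w, \big[cmul/t (kid v)]_(x <- T)
    (t (kid v) - t x ** star (t x)) ** t y = t y ** w.
  have {IH xT xT'} : forall z, z \in T -> rng z = v.
    by move=> z zT; apply: Tv; rewrite inE zT orbT.
  move=> _; elim: T {Tv} => [|z T [w IH]].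
    by exists (t (kid (src y))); rewrite big_nil -yv CK_kidl CK_kidr.
  rewrite big_cons -cmulA IH cmulBl !cmulA -[t (kid v)](congr1 (fun v => t (kid v)) yv).
  rewrite CK_kidl range_proj_mul -!cmulA -cmulBr.
  by eexists.
by rewrite cmulA cmulBl -yv CK_kidl -cmulA CK_star_self CK_kidr subrr cmul0l.
Qed.

(** The product of the range projections of [x] and [y] is the sum of those of their minimal common
    extensions, so when the gap is expanded every term except [t_v] stays in the span. *)
Lemma gap_span v (W : set (kpath L)) T : (forall x, W x -> rng x = v) ->
  (forall x y ab, W x -> W y -> Lmin x y ab -> W (kcomp x ab.1)) ->
  (forall x, x \in T -> W x) ->
  lspan ((fun x => t x ** star (t x)) @` W) (t (kid v) - gap v T).
Proof.
move=> Wv WM; rewrite /gap; set S := lspan _.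
have SL : linear_closed S by exact: lspan_closed.
have WS x : W x -> S (t x ** star (t x)).
  by move=> Wx; apply: (sub_lspan (G := _ @` _)); exists x.
have eS x s : W x -> S s -> S (t x ** star (t x) ** s).
  move=> Wx; move: s; apply: lspan_mulr => // _ [y Wy <-]; rewrite CK_mul_star //.
  apply: linear_closed_sum => // -[a b] /in_Lmin ab.
  by have := WM _ _ _ Wx Wy ab; case: ab => /= _ _ <- _; exact: WS.
have vS s : S s -> S (t (kid v) ** s).
  by apply: lspan_mulr => // _ [y Wy <-]; rewrite cmulA -(Wv _ Wy) CK_kidl; exact: WS.
elim: T => [|x T IH] TW; first by rewrite big_nil subrr; case: SL.
have Wx : W x by apply: TW; rewrite inE eqxx.
have {}IH := IH (fun y yT => TW y (mem_behead (s := x :: T) yT)).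
rewrite big_cons; set g := \big[_/_]_(_ <- _) _ in IH *.
(* With [e] the range projection of [x], this is [1 - (1 - e) g = (1 - g) + (e - e (1 - g))] in the
   corner at [v]. *)
have -> : t (kid v) - (t (kid v) - t x ** star (t x)) ** g =
    t (kid v) ** (t (kid v) - g) +
    (t x ** star (t x) - t x ** star (t x) ** (t (kid v) - g)).
  have xv : t x ** star (t x) ** t (kid v) = t x ** star (t x).
    by rewrite -cmulA -(Wv _ Wx) CK_starr.
  by rewrite cmulBl !cmulBr CK_kid_idem xv subKr opprB addrA addrAC.
apply: (linear_closedD SL); first exact: vS.
by apply: (linear_closedB SL); [exact: WS|exact: eS].
Qed.

End CKCalculus.

(** * Injectivity on the finite-dimensional cores *)

Section StarHom.
Variables (R : realType) (A B : cstarAlgType R) (f : A -> B) (fH : star_hom f).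

Lemma star_homZD (c : R[i]) a b : f (c *: a + b) = c *: f a + f b.
Proof. exact: (star_hom_linear fH). Qed.

Lemma star_hom0 : f 0 = 0.
Proof. by have := star_homZD (-1) 0 0; rewrite !scaleN1r !addNr. Qed.

Lemma star_homZ (c : R[i]) a : f (c *: a) = c *: f a.
Proof. by have := star_homZD c a 0; rewrite star_hom0 !addr0. Qed.

Lemma star_homD a b : f (a + b) = f a + f b.
Proof. by have := star_homZD 1 a b; rewrite !scale1r. Qed.

Lemma star_homB a b : f (a - b) = f a - f b.
Proof. by have := star_homZD (-1) b a; rewrite !scaleN1r addrC => ->; rewrite addrC. Qed.

End StarHom.

Section CoreInjective.
Variables (R : realType) (k : nat) (L : kgraph k) (A B : cstarAlgType R).
Variables (s : kpath L -> A) (t : kpath L -> B).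
Variables (sCK : CK_family s) (tCK : CK_family t) (L_fa : finitely_aligned L).
Variables (f : A -> B) (fH : star_hom f) (fs : forall l, f (s l) = t l).
Variables (H : set (kpath L)) (Hf : finite_set H) (Hc : matching_closed H).

Lemma hom_gap v T : f (gap s v T) = gap t v T.
Proof.
rewrite /gap; elim: T => [|x T IH]; first by rewrite !big_nil fs.
by rewrite !big_cons (star_homM fH) IH star_homB // (star_homM fH) (star_homS fH) !fs.
Qed.

(** Only the tails are recorded: they start at [src l], and for [l] in [H] they depend only on its
    degree and source, so both sides of [compress] see the same gap. *)
Definition extensions (l : kpath L) : set (kpath L) :=
  [set b | [/\ src l = rng b, H (kcomp l b) & deg b <> 0]].

Lemma finite_extensions l : finite_set (extensions l).
Proof.
apply: (@sub_finite_set _ _ (\bigcup_(x in H)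
  [set b | exists2 a, src a = rng b & x = kcomp a b])).
  by move=> b [lb Hlb _]; exists (kcomp l b) => //; exists l.
by apply: bigcup_finite => // x _; exact: finite_tails.
Qed.

Local Notation ext l := (fset_set (extensions l)).

Lemma in_ext l b : (b \in (ext l : seq _)) -> extensions l b.
Proof. by rewrite in_fset_set ?inE //; exact: finite_extensions. Qed.

Lemma extP l b : extensions l b -> b \in (ext l : seq _).
Proof. by move=> lb; rewrite in_fset_set ?inE //; exact: finite_extensions. Qed.

Lemma extensions_eq l m : H l -> H m -> deg l = deg m -> src l = src m ->
  extensions l = extensions m.
Proof.
have half x y : H x -> H y -> deg x = deg y -> src x = src y ->
    extensions x `<=` extensions y.
  move=> Hx Hy xy sxy b [xb Hxb b0]; split=> //; first by rewrite -sxy.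
  exact: (Hc.2 y x).
by move=> Hl Hm lm slm; apply/seteqP; split; apply: half.
Qed.

(** A minimal common extension [l a] lies in [H]. If [a] has nonzero degree, the gap kills it; if
    not, [l] extends [x], and the degree inequality forces [l = x]. *)
Lemma gap_annihilate (C : cstarAlgType R) (u : kpath L -> C) (uCK : CK_family u) l x :
  H l -> H x -> (total_degree (deg l) <= total_degree (deg x))%N -> l <> x ->
  gap u (src l) (ext l) ** (star (u l) ** u x) = 0.
Proof.
move=> Hl Hx lx nlx; rewrite (CK_minE uCK) // cmul_sumr big_seq big1 // => -[a b].
move=> /(in_Lmin L_fa) ab; have Hla := Hc.1 _ _ _ Hl Hx ab.
have [/= la xb e _] := ab; rewrite cmulA.
have [a0|a0] := eqVneq (deg a) 0.
  case: nlx; have := e; rewrite kcomp_deg0 // => le; rewrite le kcomp_deg0 //.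
  apply: total_degree_eq0; move: lx; rewrite le deg_kcomp // total_degreeD; lia.
rewrite (gap_kill uCK) ?cmul0l // => [y /in_ext[]//|].
by apply: extP; split=> //; exact/eqP.
Qed.

(* Since [gap] annihilates the proper extensions of [l] and [m] in [H], this reads
   off the coefficient of [u_l u_m^*] modulo higher degrees. *)
Definition compress (C : cstarAlgType R) (u : kpath L -> C) l m (a : C) : C :=
  gap u (src l) (ext l) ** star (u l) ** a ** (u m ** star (gap u (src m) (ext m))).

Lemma compress_linear (C : cstarAlgType R) (u : kpath L -> C) l m (c : R[i]) a b :
  compress u l m (c *: a + b) = c *: compress u l m a + compress u l m b.
Proof. by rewrite /compress cmulDr cmulDl cmulZr cmulZl. Qed.

(** The compression splits into a factor comparing [l] with [x] and the adjoint of one comparing [m]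
    with [y]; a mismatch in either makes that factor vanish by [gap_annihilate]. *)
Lemma compress_unit (C : cstarAlgType R) (u : kpath L -> C) (uCK : CK_family u)
    l m x y :
  core_pairs H 0 (l, m) -> core_pairs H (total_degree (deg l)) (x, y) ->
  compress u l m (u x ** star (u y)) =
  if (l, m) == (x, y) then
    gap u (src l) (ext l) ** star (gap u (src l) (ext l)) else 0.
Proof.
move=> [/= Hl Hm lm slm _] [/= Hx Hy xy sxy lx].
have -> : compress u l m (u x ** star (u y)) =
    (gap u (src l) (ext l) ** (star (u l) ** u x))
    ** star (gap u (src m) (ext m) ** (star (u m) ** u y)).
  by rewrite /compress !starM starK !cmulA.
have [[<- <-]|nlx] := eqVneq (l, m) (x, y).
  by rewrite !(CK_star_self uCK) !(gap_kidr uCK) (extensions_eq Hl Hm) // slm.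
have [lxE|lxN] := pselect (l = x); last by rewrite gap_annihilate // cmul0l.
rewrite (@gap_annihilate _ _ uCK m y) ?star0 ?cmul0r //; first by rewrite -lm -xy.
by move=> my; move: nlx; rewrite lxE my eqxx.
Qed.

Lemma core_split (C : cstarAlgType R) (u : kpath L -> C) j a : core u H j a ->
  exists (c : kpath L * kpath L -> R[i]) h, core u H j.+1 h /\
    a = \sum_(p <- fset_set [set p | core_pairs H j p /\ total_degree (deg p.1) = j])
          c p *: (u p.1 ** star (u p.2)) + h.
Proof.
set Q := [set p | _]; move=> aj.
have Qf : finite_set Q.
  by apply: (sub_finite_set _ (finite_core_pairs j Hf)) => p [].
pose F p := u p.1 ** star (u p.2).
suff [y [h [yQ hj ->]]] : exists y h, [/\ lspan (F @` Q) y, core u H j.+1 h & a = y + h].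
  by move: yQ; rewrite lspan_imageE // => -[c ->]; exists c, h.
have QL : linear_closed (lspan (F @` Q)) by exact: lspan_closed.
have cL := core_linear u H j.+1.
move: a aj; apply: lspan_sub.
  split=> [|c a b [y [h [yQ hj ->]]] [y' [h' [yQ' hj' ->]]]].
    by exists 0, 0; rewrite addr0; split=> //; [case: QL|case: cL].
  exists (c *: y + y'), (c *: h + h'); split; [exact: QL.2|exact: cL.2|].
  by rewrite scalerDr addrACA.
move=> _ [[l m] lmj <-] /=.
have [lj|lj] := eqVneq (total_degree (deg l)) j.
  exists (F (l, m)), 0; rewrite addr0; split=> //; last by case: cL.
  by apply: (sub_lspan (G := F @` Q)); exists (l, m).
exists 0, (F (l, m)); rewrite add0r; split=> //; first by case: QL.
case: lmj => /= Hl Hm lm slm jl; apply: core_mem => //.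
by rewrite ltn_neqAle eq_sym lj.
Qed.

(** If [T] missed [m], the zero gap would fix [t_m], so [t_m^* t_m], the projection at [src m],
    would vanish. *)
Lemma gap0_exhaustive v T : (forall w, t (kid w) <> 0) ->
  (forall x, x \in T -> rng x = v) -> gap t v T = 0 -> exhaustive v [set` T].
Proof.
move=> tw Tv gT; split=> [x|m mv]; first exact: Tv.
apply: contrapT => nm; apply: (tw (src m)).
rewrite -(CK_star_self tCK) -(gap_fix tCK mv (T := T)) ?gT ?cmul0l ?cmul0r //.
move=> x xT; apply: contrapT => /eqP/set0P xm.
by apply: nm; exists x.
Qed.

Lemma core_step (tv : forall v, t (kid v) <> 0) j a :
  core s H j a -> f a = 0 -> core s H j.+1 a.
Proof.
move=> /core_split[c [h [hj aE]]] fa0.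
set Q := [set p | _] in aE; set F := fun p => s p.1 ** star (s p.2).
have Qf : finite_set Q.
  by apply: (sub_finite_set _ (finite_core_pairs j Hf)) => p [].
rewrite aE; apply: (linear_closedD (core_linear s H j.+1)) => //.
apply: (linear_closed_sum (core_linear s H j.+1)) => -[l m].
rewrite in_fset_set // inE => -[lmj /= lj].
have [Hl Hm lm slm _] := lmj; rewrite /= in Hl Hm lm slm.
have lm0 : core_pairs H 0 (l, m) by [].
set g := gap s (src l) (ext l).
(* All monomials of [a] have total degree at least [j], that of [l], so only the [(l, m)] term
   survives. *)
have compress_a : compress s l m a = c (l, m) *: (g ** star g).
  have c0 : compress s l m 0 = 0 by rewrite /compress cmul0r cmul0l.
  have cD x y : compress s l m (x + y) = compress s l m x + compress s l m y.
    by have := compress_linear s l m 1 x y; rewrite !scale1r.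
  have -> : compress s l m a = \sum_(p <- fset_set Q) compress s l m (c p *: F p).
    rewrite aE cD (_ : compress s l m h = 0) ?addr0.
      exact: (big_morph (compress s l m)).
    move: h hj {aE}; apply: (lspan_sub (S := [set h | compress s l m h = 0])).
      split=> // z x y x0 y0; rewrite /= compress_linear x0 y0.
      by rewrite scaler0 addr0.
    move=> _ [[x y] [/= Hx Hy xy sxy jx] <-] /=; rewrite (compress_unit sCK) //.
      case: eqP => // -[lx _]; move: jx; rewrite -lx lj ltnn //.
    by split=> //=; rewrite lj ltnW.
  have cZ z x : compress s l m (z *: x) = z *: compress s l m x.
    by have := compress_linear s l m z x 0; rewrite c0 !addr0.
  rewrite (bigD1_seq (l, m)) ?fset_uniq ?in_fset_set ?inE //=.
  rewrite cZ (compress_unit sCK) ?eqxx // ?lj // big_seq_cond big1 ?addr0 //.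
  move=> [x y] /=; move=> /andP[+ nxy]; rewrite in_fset_set // inE => -[xyj _].
  by rewrite cZ (compress_unit sCK) ?lj // eq_sym (negPf nxy) scaler0.
(* Under [f] the compression of [a] goes to 0, so either the coefficient or the gap in [B] vanishes.
   In the second case the extensions are exhaustive, and [CK_product] makes the gap in [A] vanish
   too. *)
have : c (l, m) *: (gap t (src l) (ext l) ** star (gap t (src l) (ext l))) = 0.
  rewrite -hom_gap -(star_homS fH) -(star_homM fH) -star_homZ // -compress_a.
  by rewrite /compress !(star_homM fH) fa0 cmul0r cmul0l.
move/eqP; rewrite scaler_eq0 => /orP[/eqP ->|/eqP/mul_star_eq0 g0].
  by rewrite scale0r; case: (core_linear s H j.+1).
apply: (linear_closedZ _ (core_linear s H j.+1)).
have ex : exhaustive (src l) [set` ext l].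
  by apply: gap0_exhaustive => // x /in_ext[].
have g0s : g = 0 by exact: (CK_product sCK ex).
(* Expanding [s_v - g], where [g = 0], over the extensions [b] turns [s_l s_m^*] into a combination
   of monomials [s_(l b) s_(m b)^*] of higher total degree. *)
rewrite /=; have -> : s l ** star (s m) = s l ** (s (kid (src l)) - g) ** star (s m).
  by rewrite g0s subr0 (CK_kidr sCK).
have : lspan ((fun x => s x ** star (s x)) @` extensions l) (s (kid (src l)) - g).
  apply: gap_span => // [x []//|x y [a' b'] [lx Hlx x0] [ly Hly y0] ab|x /in_ext //].
  (* Prefixing [l] turns a minimal common extension of [x] and [y] into one of [l x] and [l y], both
     in [H]. *)
  have [/= xa yb e dE] := ab.
  split=> /=.
  - by rewrite rng_kcomp.
  - rewrite kcompA //; apply: (Hc.1 _ _ (a', b') Hlx Hly); split=> /=.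
    + by rewrite src_kcomp.
    + by rewrite src_kcomp.
    + by rewrite -!kcompA // e.
    + rewrite -kcompA // deg_kcomp ?rng_kcomp // dE !deg_kcomp //.
      by apply/ffunP => i; rewrite !ffunE; exact: addn_maxr.
  - rewrite deg_kcomp // => xa0; apply: x0; apply: total_degree_eq0.
    have := congr1 (@total_degree k) xa0; rewrite total_degreeD.
    by rewrite /total_degree [in RHS]big1 => [|i _]; [lia|rewrite ffunE].
move: (_ - _); apply: lspan_sub => [|_ [b lb <-] /=].
  apply: linear_closed_preim => [z x y|]; last exact: core_linear.
  by rewrite cmulDr cmulDl cmulZr cmulZl.
have [slb Hlb b0] := lb.
have [smb Hmb _] : extensions m b by rewrite -(extensions_eq Hl Hm).
rewrite !cmulA (CK_comp sCK) // -cmulA -starM (CK_comp sCK) //.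
apply: core_mem; rewrite ?deg_kcomp ?src_kcomp ?lm //.
rewrite total_degreeD -lm lj -addn1 leq_add2l lt0n.
by apply/eqP => /total_degree_eq0.
Qed.

End CoreInjective.

(** * Isometry on the cores *)

Section CoreIsometry.
Variables (R : realType) (k : nat) (L : kgraph k) (A B : cstarAlgType R).
Variables (s : kpath L -> A) (t : kpath L -> B).
Variables (sCK : CK_family s) (tCK : CK_family t) (L_fa : finitely_aligned L).
Variables (f : A -> B) (fH : star_hom f) (fs : forall l, f (s l) = t l).
Variables (H : set (kpath L)) (Hf : finite_set H) (Hc : matching_closed H).
Variable tv : forall v, t (kid v) <> 0.

Lemma core_injective a : core s H 0 a -> f a = 0 -> a = 0.
Proof.
move=> a0 fa.
have aj j : core s H j a.
  elim: j => // j IH; exact: (core_step sCK tCK L_fa fH fs Hf Hc).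
(* [J] exceeds every total degree in [H], so no monomial is left. *)
pose J := (\max_(l <- fset_set H) total_degree (deg l)).+1%N.
have := aj J; rewrite /core; apply: (lspan_sub (S := [set 0])).
  by split=> // c x y -> ->; rewrite scaler0 addr0.
move=> y [[l m] [/= Hl _ _ _ +] _]; rewrite leqNgt ltnS => /negP[].
apply: (@leq_bigmax_seq _ _ xpredT (fun l => total_degree (deg l))) => //.
by rewrite in_fset_set // inE.
Qed.

(** Both [f] and its inverse between the cores are contractive, the cores being C*-subalgebras. *)
Lemma core_isometry a : core s H 0 a -> rnorm a = rnorm (f a).
Proof.
move=> a0; apply/le_anti; rewrite (star_hom_contractive fH) andbT.
(* The inverse of [f] on the core in [B]; the value 0 elsewhere is a dummy. *)
pose g b := if pselect (exists2 a, core s H 0 a & f a = b) is left e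
  then s2val (cid2 e) else 0.
have sL := core_linear s H 0.
have fI x y : core s H 0 x -> core s H 0 y -> f x = f y -> x = y.
  move=> x0 y0 fxy; apply/subr0_eq/core_injective.
    exact: (linear_closedB sL).
  by rewrite star_homB // fxy subrr.
have gf x : core s H 0 x -> g (f x) = x.
  move=> x0; rewrite /g; case: pselect => [e|[]]; last by exists x.
  by case: cid2 => y /= y0 /fI; exact.
have ts : core t H 0 `<=` f @` core s H 0.
  apply: lspan_sub.
    split=> [|c _ _ [x x0 <-] [y y0 <-]].
      by exists 0; [case: sL|exact: star_hom0].
    by exists (c *: x + y); [exact: sL.2|exact: star_homZD].
  move=> _ [[l m] lm <-]; exists (s l ** star (s m)).
    by apply: (sub_lspan (G := _ @` _)); exists (l, m).
  by rewrite (star_homM fH) (star_homS fH) !fs.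
have st x : core s H 0 x -> core t H 0 (f x).
  apply: (lspan_sub (S := f @^-1` core t H 0)).
    by apply: linear_closed_preim; [exact: star_homZD|exact: core_linear].
  move=> _ [[l m] lm <-] /=; rewrite (star_homM fH) (star_homS fH) !fs.
  by apply: (sub_lspan (G := _ @` _)); exists (l, m).
have sM := cstar_subalgebraM (core_cstar_subalgebra sCK L_fa Hf Hc).
have sS := cstar_subalgebraS (core_cstar_subalgebra sCK L_fa Hf Hc).
rewrite -{1}(gf a a0).
apply: (hom_contractive (core_cstar_subalgebra tCK L_fa Hf Hc)); last exact: st.
- move=> c _ _ /ts[x x0 <-] /ts[y y0 <-].
  by rewrite -star_homZD // !gf //; exact: sL.2.
- move=> _ _ /ts[x x0 <-] /ts[y y0 <-].
  by rewrite -(star_homM fH) !gf //; exact: sM.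
- move=> _ /ts[x x0 <-].
  by rewrite -(star_homS fH) !gf //; exact: sS.
Qed.

End CoreIsometry.

(** * Closures of *-subalgebras *)

Section Closure.
Variables (R : realType).

Lemma closed_lipschitz_preim (A B : cstarAlgType R) (f : A -> B) (K : R) (T : set B) :
  (forall x y, rnorm (f x - f y) <= K * rnorm (x - y)) -> closed T ->
  closed (f @^-1` T).
Proof.
move=> fK cT; apply: closed_rnormP => a aT; apply/cT/closure_rnormP => e e0.
have K0 : 0 <= `|K| by exact: normr_ge0.
have K1 : 0 < `|K| + 1 by rewrite ltr_wpDl.
have [b Tb ab] := aT _ (divr_gt0 e0 K1); exists (f b) => //.
rewrite (le_lt_trans (fK _ _)) //.
rewrite (@le_lt_trans _ _ ((`|K| + 1) * rnorm (a - b))) //.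
  by rewrite ler_wpM2r ?rnorm_ge0 // (le_trans (ler_norm K)) // lerDl.
by rewrite mulrC -ltr_pdivlMr.
Qed.

Lemma closure_sub_closed (T : topologicalType) (S C : set T) :
  closed C -> S `<=` C -> closure S `<=` C.
Proof. by move=> cC SC; rewrite (closure_id C).1 //; exact: closureS. Qed.

(** The operations are Lipschitz in each argument, and the binary ones are extended to the closure
    one argument at a time. *)
Lemma closure_star_subalgebra (A : cstarAlgType R) (S : set A) :
  star_subalgebra S -> cstar_subalgebra (closure S).
Proof.
move=> [S0 SZD SM SS]; split; last exact: closed_closure.
have cc : closed (closure S) by exact: closed_closure.
have sc := @subset_closure _ S.
split.
- exact: sc.
- move=> c a b; move=> Sa Sb; move: a Sa.
  apply: (closure_sub_closed (C := (fun a => c *: a + b) @^-1` closure S)).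
    apply: (closed_lipschitz_preim (K := complex.Re `|c|)) => // x y.
    by rewrite opprD addrACA subrr addr0 -scalerBr rnormZ.
  move=> a Sa /=; move: b Sb.
  apply: (closure_sub_closed (C := (fun b => c *: a + b) @^-1` closure S)).
    apply: (closed_lipschitz_preim (K := 1)) => // x y.
    by rewrite opprD addrACA subrr add0r mul1r.
  by move=> b Sb; apply: sc; exact: SZD.
- move=> a b Sa Sb; move: a Sa.
  apply: (closure_sub_closed (C := (fun a => a ** b) @^-1` closure S)).
    apply: (closed_lipschitz_preim (K := rnorm b)) => // x y.
    by rewrite -cmulBl mulrC rnormM.
  move=> a Sa /=; move: b Sb.
  apply: (closure_sub_closed (C := (fun b => a ** b) @^-1` closure S)).
    apply: (closed_lipschitz_preim (K := rnorm a)) => // x y.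
    by rewrite -cmulBr rnormM.
  by move=> b Sb; apply: sc; exact: SM.
- apply: (closure_sub_closed (C := @star R A @^-1` closure S)).
    apply: (closed_lipschitz_preim (K := 1)) => // x y.
    by rewrite -starB rnorm_star mul1r.
  by move=> a Sa; apply: sc; exact: SS.
Qed.

End Closure.

(** * The fixed-point algebra of the gauge action *)

Section GaugeFixed.
Variables (R : realType) (k : nat) (L : kgraph k) (L_fa : finitely_aligned L).
Variable (U : graph_calg R L).
Let s := gc_gen U.
Let sCK : CK_family s := gc_CK U.

Lemma unit_root_neg1 (n : nat) : (0 < n)%N ->
  exists2 w : R[i], `|w| = 1 & w ^+ n = -1.
Proof.
move=> n0; exists (n.-root (-1)); last exact: rootCK.
by apply/eqP; rewrite -(pexpr_eq1 n0) // -normrX rootCK // normrN1.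
Qed.

Lemma zpow_separate (p q : degree k) : p <> q ->
  exists z : torus R k, zpow z p * (zpow z q)^* = -1.
Proof.
move=> pq; have [i pqi] : exists i, p i <> q i.
  apply: contrapT => npq; apply/pq/ffunP => i.
  by apply: contrapT => ?; apply: npq; exists i.
(* Subtraction is truncated, so [n] is the distance between [p i] and [q i]; an [n]-th root of -1
   goes in coordinate [i], and 1 elsewhere. *)
pose n := (p i - q i + (q i - p i))%N.
have [|w w1 wn] := @unit_root_neg1 n; first by rewrite /n; lia.
have zP j : `|if j == i then w else 1| = 1 by case: eqP; rewrite ?normr1.
exists (exist _ _ zP); rewrite zpow_conj.
have zE (m : degree k) : zpow (exist _ _ zP) m = w ^+ m i.
  rewrite /zpow (bigD1 i) //= eqxx big1 ?mulr1 // => j /negPf ->.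
  by rewrite expr1n.
rewrite !zE; have w0 : w != 0 by rewrite -normr_eq0 w1 oner_eq0.
have [lt|le] := ltnP (q i) (p i).
  by rewrite -expfB // (_ : (p i - q i)%N = n) ?wn // /n; lia.
rewrite -[LHS]invrK invfM invrK mulrC -expfB; last by lia.
by rewrite (_ : (q i - p i)%N = n) ?wn ?invrN1 // /n; lia.
Qed.

Lemma gauge_monomial z l m : gauge z (s l ** star (s m)) =
  (zpow z (deg l) * (zpow z (deg m))^*) *: (s l ** star (s m)).
Proof.
rewrite (star_homM (gauge_hom U z)) (star_homS (gauge_hom U z)) !gaugeE.
by rewrite starZ cmulZl cmulZr scalerA.
Qed.

Lemma gauge_fixed_linear : linear_closed (gauge_fixed U).
Proof.
split=> [z|c a b Ga Gb z]; first exact: star_hom0 (gauge_hom U z).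
by rewrite (star_homZD (gauge_hom U z)) Ga Gb.
Qed.

Lemma gauge_fixed_cstar_subalgebra : cstar_subalgebra (gauge_fixed U).
Proof.
have [G0 GZD] := gauge_fixed_linear; split.
  split=> // [a b Ga Gb z|a Ga z].
    by rewrite (star_homM (gauge_hom U z)) Ga Gb.
  by rewrite (star_homS (gauge_hom U z)) Ga.
apply: closed_rnormP => a aG z;
apply/subr0_eq/(@rnorm_small_eq0 _ _ 2) => e /aG[b Gb ab].
have -> : gauge z a - a = gauge z (a - b) - (a - b).
  by rewrite (star_homB (gauge_hom U z)) Gb opprB addrA subrK.
rewrite (le_trans (rnormD _ _)) // rnormN mulr_natl mulr2n lerD //; last exact: ltW.
by rewrite (le_trans (star_hom_contractive (gauge_hom U z) _)) // ltW.
Qed.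

Definition core_union : set U :=
  [set a | exists H, [/\ finite_set H, matching_closed H & core s H 0 a]].

Lemma coreS (H H' : set (kpath L)) : H `<=` H' -> core s H 0 `<=` core s H' 0.
Proof.
move=> HH; apply: lspanS => _ [lm [Hl Hm dlm slm j] <-]; exists lm => //.
by split=> //; exact: HH.
Qed.

Lemma core_directed (H H' : set (kpath L)) : finite_set H -> finite_set H' ->
  exists K, [/\ finite_set K, matching_closed K, core s H 0 `<=` core s K 0
              & core s H' 0 `<=` core s K 0].
Proof.
move=> Hf Hf'; have [|K [Kf HK Kc]] := @matching_closure _ _ (H `|` H') L_fa.
  by rewrite finite_setU.
by exists K; split=> //; apply: coreS => l Hl; apply: HK; [left|right].
Qed.

Lemma core_union_linear : linear_closed core_union.
Proof.
split=> [|c a b [H [Hf Hc Ha]] [H' [Hf' Hc' Hb]]].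
  have [K [Kf _ Kc]] := matching_closure L_fa (@finite_set0 (kpath L)).
  by exists K; split=> //; case: (core_linear s K 0).
have [K [Kf Kc HK HK']] := core_directed Hf Hf'; exists K; split=> //.
by apply: (core_linear s K 0).2; [exact: HK|exact: HK'].
Qed.

Lemma core_union_monomial l m : deg l = deg m -> src l = src m ->
  core_union (s l ** star (s m)).
Proof.
move=> dlm slm; have [|K [Kf HK Kc]] := @matching_closure _ _ [set l; m] L_fa.
  by rewrite finite_setU; split; exact: finite_set1.
by exists K; split=> //; apply: core_mem => //; apply: HK; [left|right].
Qed.

Lemma core_union_fixed : core_union `<=` gauge_fixed U.
Proof.
move=> a [H [_ _]]; move: a; apply: lspan_sub; first exact: gauge_fixed_linear.
move=> _ [[l m] [/= _ _ dlm _ _] <-] z; rewrite gauge_monomial dlm.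
by rewrite zpow_conj mulfV ?scale1r // zpow_neq0.
Qed.

(** * Approximation of invariant elements by averaging *)

Definition monomials : set U :=
  (fun lm => s lm.1 ** star (s lm.2)) @` [set lm | src lm.1 = src lm.2].

Lemma monomials_dense : closure (lspan monomials) = setT.
Proof.
apply: (@gc_generates _ _ _ U).
  apply: closure_star_subalgebra; apply: lspan_star_subalgebra.
    move=> _ [[l m] /= lm <-]; rewrite starM starK.
    by exists (m, l).
  move=> _ _ [[l m] /= lm <-] [[x y] /= xy <-]; rewrite (CK_mul_star sCK) //.
  apply: (linear_closed_sum (S := lspan monomials)); first exact: lspan_closed.
  move=> [a b] /(in_Lmin L_fa)[/= ma xb e _].
  apply: (sub_lspan (G := monomials)).
  exists (kcomp l a, kcomp y b) => //=.
  by rewrite !src_kcomp ?lm -?xy // -(src_kcomp ma) e src_kcomp.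
move=> l; apply: subset_closure; apply: (sub_lspan (G := monomials)).
exists (l, kid (src l)); first by rewrite /= src_kid.
by rewrite /= (CK_star_kid sCK) (CK_kidr sCK).
Qed.

(** A list of terms, because its length is the induction measure in [core_union_approx]. *)
Lemma lspan_monomialsP x : lspan monomials x ->
  exists c : seq (R[i] * (kpath L * kpath L)),
    (forall p, p \in c -> src p.2.1 = src p.2.2) /\
    x = \sum_(p <- c) p.1 *: (s p.2.1 ** star (s p.2.2)).
Proof.
move: x; apply: lspan_sub.
  split=> [|z a b [c [cP ->]] [d [dP ->]]]; first by exists [::]; rewrite big_nil.
  exists ([seq (z * p.1, p.2) | p <- c] ++ d); split.
    by move=> p; rewrite mem_cat => /orP[/mapP[q /cP qP ->]|/dP].
  rewrite big_cat big_map scaler_sumr; congr (_ + _).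
  by apply: eq_bigr => p _; rewrite scalerA.
move=> _ [lm slm <-]; exists [:: (1, lm)]; split; last by rewrite big_seq1 scale1r.
by move=> p; rewrite inE => /eqP ->.
Qed.

(* Averaging over [{1, gauge z}] with [z] chosen so that the leading monomial is
   an eigenvector of eigenvalue -1 kills that monomial, does not increase norms
   and fixes the gauge-invariant elements. *)
Lemma core_union_approx (a x : U) : gauge_fixed U a -> lspan monomials x ->
  exists2 y, core_union y & rnorm (a - y) <= rnorm (a - x).
Proof.
move=> Ga /lspan_monomialsP[c [cP ->]].
(* The accumulator [y0] receives the terms with [deg l = deg m]; the list holds those still to be
   treated. *)
suff : forall n (c : seq (R[i] * (kpath L * kpath L))) y0, size c = n ->
    (forall p, p \in c -> src p.2.1 = src p.2.2) -> core_union y0 ->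
    exists2 y, core_union y & rnorm (a - y) <=
      rnorm (a - (\sum_(p <- c) p.1 *: (s p.2.1 ** star (s p.2.2)) + y0)).
  move=> /(_ _ c 0 erefl cP)[|y yU ya]; first by case: core_union_linear.
  by exists y => //; rewrite addr0 in ya.
elim=> [|n IH] {cP}c y0.
  by move=> /size0nil -> _ y0U; exists y0; rewrite // big_nil add0r.
case: c => // -[c [l m]] r [rn] cP y0U.
have slm : src l = src m by apply: (cP (c, (l, m))); rewrite inE eqxx.
have rP p : p \in r -> src p.2.1 = src p.2.2.
  by move=> pr; apply: cP; rewrite inE pr orbT.
rewrite big_cons /=; have [dlm|dlm] := pselect (deg l = deg m).
  have [|y yU ya] := IH r (c *: (s l ** star (s m)) + y0) rn rP.
    by apply: core_union_linear.2 => //; exact: core_union_monomial.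
  by exists y => //; rewrite addrA [X in X + y0]addrC in ya.
have [z zlm] := zpow_separate dlm.
have gH := gauge_hom U z.
pose P (b : U) : U := 2^-1 *: (b + gauge z b).
have P_fixed b : gauge_fixed U b -> P b = b.
  move=> Gx; have b2 : b + b = 2 *: b by rewrite scaler_nat mulr2n.
  by rewrite /P Gx b2 scalerA mulVf ?scale1r // pnatr_eq0.
have PD b d : P (b + d) = P b + P d.
  by rewrite /P (star_homD gH) -scalerDr addrACA.
have PB b d : P (b - d) = P b - P d.
  by rewrite /P (star_homB gH) -scalerBr opprD addrACA.
have P_le b : rnorm (P b) <= rnorm b.
  rewrite rnormZ.
  have -> : complex.Re `|2^-1 : R[i]| = 2^-1.
    have -> : 2^-1 = ((2^-1 : R)%:C)%C :> R[i] by rewrite rmorphV ?unitfE //= rmorph_nat.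
    by rewrite Re_norm_real // invr_ge0.
  rewrite ler_pdivrMl // (le_trans (rnormD _ _)) // mulr_natl mulr2n lerD //.
  exact: star_hom_contractive.
(* [P] scales each monomial by [w], which vanishes at the leading one by the choice of [z]. *)
pose w (p : R[i] * (kpath L * kpath L)) :=
  2^-1 * (1 + zpow z (deg p.2.1) * (zpow z (deg p.2.2))^*).
have P_mon p : P (p.1 *: (s p.2.1 ** star (s p.2.2))) =
    (p.1 * w p) *: (s p.2.1 ** star (s p.2.2)).
  rewrite /P (star_homZ gH) gauge_monomial scalerA -scalerDl scalerA /w.
  by congr (_ *: _); ring.
have [|||y yU ya] := IH [seq (p.1 * w p, p.2) | p <- r] y0.
- by rewrite size_map.
- by move=> _ /mapP[p pr ->]; exact: (rP p).
- by [].
exists y => //; apply: le_trans ya _.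
rewrite big_map /=.
(* The new error is [P] of the old one, since [P] fixes [a] and [y0] and drops the leading term. *)
suff -> : a - (\sum_(p <- r) (p.1 * w p) *: (s p.2.1 ** star (s p.2.2)) + y0) =
    P (a - (c *: (s l ** star (s m)) +
            \sum_(p <- r) p.1 *: (s p.2.1 ** star (s p.2.2)) + y0)).
  exact: P_le.
rewrite PB !PD (P_fixed a) // (P_fixed y0); last exact: core_union_fixed.
rewrite (P_mon (c, (l, m))) /w /= zlm subrr !mulr0 scale0r add0r.
congr (_ - (_ + _)); rewrite (big_morph P PD (id1 := 0)).
  by apply: eq_bigr => p _; rewrite P_mon.
by rewrite /P (star_hom0 gH) addr0 scaler0.
Qed.

Lemma gauge_fixed_closure : gauge_fixed U = closure core_union.
Proof.
apply/seteqP; split; last first.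
  exact: closure_sub_closed gauge_fixed_cstar_subalgebra.2 core_union_fixed.
move=> a Ga; apply/closure_rnormP => e e0.
have : closure (lspan monomials) a by rewrite monomials_dense.
move=> /closure_rnormP/(_ e e0)[x xM xa].
have [y yU ya] := core_union_approx Ga xM.
by exists y => //; exact: le_lt_trans xa.
Qed.

Lemma gauge_fixed_AF : AF (gauge_fixed U).
Proof.
split; first exact: gauge_fixed_cstar_subalgebra.
exists [set D | exists H, [/\ finite_set H, matching_closed H & D = core s H 0]].
split.
- have [K [Kf _ Kc]] := matching_closure L_fa (@finite_set0 (kpath L)).
  by exists (core s K 0), K.
- move=> _ [H [Hf Hc ->]]; split.
  + exact: core_cstar_subalgebra.
  + by apply: lspan_finite_dimensional; exact: finite_core_pairs.
  + by move=> a Ha; apply: core_union_fixed; exists H.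
- move=> _ _ [H [Hf Hc ->]] [H' [Hf' Hc' ->]].
  have [K [Kf Kc HK HK']] := core_directed Hf Hf'.
  by exists (core s K 0); split=> //; exists K.
- rewrite gauge_fixed_closure; congr closure; apply/seteqP; split=> a.
    by move=> [H [Hf Hc Ha]]; exists (core s H 0) => //; exists H.
  by move=> [_ [H [Hf Hc ->]] Ha]; exists H.
Qed.

(** With [y] in a core within [e / 2] of [a], contractivity gives
    [|a| <= |a - y| + |f y| <= |f a| + e] for [f] the representation. *)
Lemma gc_rep_isometry (B : cstarAlgType R) (t : kpath L -> B) (tCK : CK_family t) :
  (forall v : vertex L, t (kid v) <> 0) ->
  forall a, gauge_fixed U a -> rnorm (gc_rep U tCK a) = rnorm a.
Proof.
move=> tv a; rewrite gauge_fixed_closure => /closure_rnormP aU.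
have fH := gc_rep_hom U tCK; have fs := gc_repE U tCK.
apply/le_anti; rewrite (star_hom_contractive fH) /=.
apply/ler_addgt0Pl => e e0; have e20 : 0 < e / 2 by rewrite divr_gt0.
have [y [H [Hf Hc Hy]] ay] := aU _ e20.
have fy : rnorm (gc_rep U tCK y) <= rnorm (gc_rep U tCK a) + e / 2.
  have -> : gc_rep U tCK y = gc_rep U tCK a - gc_rep U tCK (a - y).
    by rewrite star_homB // subKr.
  rewrite (le_trans (rnormD _ _)) // rnormN lerD2l.
  by rewrite (le_trans (star_hom_contractive fH _)) // ltW.
have := rnormD (a - y) y; rewrite subrK (core_isometry sCK tCK L_fa fH fs Hf Hc tv Hy).
by have := ay; lra.
Qed.

End GaugeFixed.

Theorem theorem3p1 (R : realType) (k : nat) (L : kgraph k)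
    (L_fa : finitely_aligned L) (U : graph_calg R L) :
  AF (gauge_fixed U) /\
  forall (B : cstarAlgType R) (t : kpath L -> B) (tCK : CK_family t),
    (forall v : vertex L, t (kid v) <> 0) ->
    set_inj (gauge_fixed U) (gc_rep U tCK).
Proof.
split; first exact: gauge_fixed_AF.
move=> B t tCK tv a b /set_mem Ga /set_mem Gb fab.
apply/subr0_eq/eqP; rewrite -rnorm_eq0 -(gc_rep_isometry L_fa tCK tv).
  by rewrite (star_homB (gc_rep_hom U tCK)) fab subrr rnorm0.
exact: (linear_closedB (gauge_fixed_linear U)).
Qed.
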